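(* For every partition $\lambda$ of $n$, the odd Schur function $s_\lambda$ can be expressed in terms of the odd monomial functions as $$(-1)^{\binom{\lambda^T}{2}}s_\lambda=\sum_{\mu\vdash n}K_{\lambda\mu}m_\mu.$$
   Context: The algebra of odd symmetric functions: let $\Bbbk$ be a commutative ring and $\Lambda'$ the free associative $\mathbb{Z}$-graded $\Bbbk$-algebra on $h_1,h_2,\dots$ with $\deg h_n=n$; $h_0=1$. For a composition $\alpha=(a_1,\dots,a_k)$ (finite sequence of positive integers) put $h_\alpha=h_{a_1}\cdots h_{a_k}$, $|\alpha|=a_1+\dots+a_k$, $S_\alpha=S_{a_1}\times\dots\times S_{a_k}\subset S_{|\alpha|}$. The symmetric bilinear form on $\Lambda'$ is $(h_\beta,h_\alpha)=\sum_{c\in S_\beta\backslash S_n/S_\alpha}(-1)^{\ell(c)}$ if $|\alpha|=|\beta|=n$, and $0$ if $|\alpha|\ne|\beta|$, where $\ell(c)$ is the Coxeter length of the minimal length element of $c$. Let $\mathcal I$ be the radical of the form and $\Lambda=\Lambda'/\mathcal I$ with the induced grading $\Lambda=\bigoplus_n\Lambda_n$, multiplication and form. The $h_\lambda$, $\lambda\vdash n$, form a basis of $\Lambda_n$; the odd monomial functions $\{m_\lambda\}_{\lambda\vdash n}$ are the dual basis: $(h_\lambda,m_\mu)=\delta_{\lambda\mu}$. Odd Kostka numbers: for a semistandard Young tableau $T$ (entries positive integers, non-decreasing along rows, strictly increasing down columns), its row word $w_r(T)$ is obtained by reading the rows from left to right, from the bottom row to the top row; $\mathrm{sign}(T)$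 is the sign of the minimal length permutation sorting $w_r(T)$ into non-decreasing order, i.e. $(-1)$ to the number of pairs of positions $i<j$ whose letters satisfy $w_i>w_j$. The content of $T$ is $(a_1,a_2,\dots)$, $a_i$ the number of entries equal to $i$. $T_\lambda$ is the unique semistandard tableau with shape and content both $\lambda$. For $\lambda,\mu\vdash n$, $K_{\lambda\mu}=\mathrm{sign}(T_\lambda)\sum_T\mathrm{sign}(T)$, sum over semistandard $T$ of shape $\lambda$ and content $\mu$. The odd Schur functions $s_\lambda\in\Lambda_n$, $\lambda\vdash n$, are defined by $h_\mu=\sum_{\lambda\vdash n}K_{\lambda\mu}s_\lambda$ for all $\mu\vdash n$. $\lambda^T$ is the transpose (conjugate) partition, and for a partition $\nu=(\nu_1,\nu_2,\dots)$, $\binom{\nu}{2}=\sum_i\binom{\nu_i}{2}$. *)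

(* Defs.v *)
From HB Require Import structures.
From mathcomp Require Import all_boot all_order all_fingroup all_algebra.
From mathcomp Require Import generic_quotient ring_quotient.
From mathcomp Require Import finmap monalg.
From mathcomp Require Import boolp.

Set Implicit Arguments.
Unset Strict Implicit.
Unset Printing Implicit Defensive.

Import GRing.Theory.

Local Open Scope ring_scope.

Section Partitions.
Local Open Scope nat_scope.

Definition is_part_of_nat (n : nat) (la : seq nat) : bool :=
  [&& sorted geq la, 0 \notin la & sumn la == n].

Fixpoint parts_bounded (m n : nat) : seq (seq nat) :=
  if m is m'.+1 then
    flatten [seq [seq nseq j m ++ p | p <- parts_bounded m' (n - j * m)]
            | j <- iota 0 (n %/ m).+1]
  else if n is 0 then [:: [::]] else [::].

Lemma mem_parts_bounded m n la :
  is_part_of_nat n la -> all (geq m) la -> la \in parts_bounded m n.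
Proof.
elim: m n la => [|m IH] n la.
  case: la => [|a la]; first by case/and3P=> _ _ /eqP <-.
  by case/and3P=> _; rewrite inE negb_or => /andP[a0 _] _ /= /andP[];
     rewrite leqn0 eq_sym (negPf a0).
case/and3P=> s0 p0 /eqP sn ale.
pose j := count_mem m.+1 la; pose la' := [seq x <- la | x != m.+1].
have Ela : la = nseq j m.+1 ++ la'.
  rewrite {}/j {}/la' {sn p0}; elim: la s0 ale => //= a la IHla ps /andP[aM ale].
  have [Ea|Na] := eqVneq a m.+1.
    by rewrite {1}Ea /= -IHla //; exact: path_sorted ps.
  have all_lt : all (fun x => x != m.+1) la.
    have ra : transitive geq by move=> x y z xy yz; apply: leq_trans yz xy.
    apply/allP=> x xl; move/(order_path_min ra)/allP/(_ x xl): ps => /= xa.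
    by rewrite neq_ltn (leq_ltn_trans xa) // ltn_neqAle Na.
  have -> : count_mem m.+1 la = 0.
    by apply/eqP; rewrite eqn0Ngt -has_count; apply/hasPn=> x /(allP all_lt).
  by rewrite /= (all_filterP all_lt).
have sE : sumn la = j * m.+1 + sumn la' by rewrite {1}Ela sumn_cat sumn_nseq mulnC.
apply/flatten_mapP; exists j.
  by rewrite mem_iota /= add0n ltnS leq_divRL // -sn sE leq_addr.
rewrite Ela; apply/mapP; exists la' => //; apply: IH; last first.
  apply/allP=> x; rewrite mem_filter => /andP[Nx /(allP ale) /= xM].
  by rewrite -ltnS ltn_neqAle Nx.
apply/and3P; split.
- by apply: sorted_filter s0 => x y z xy yz; apply: leq_trans yz xy.
- by rewrite mem_filter negb_and p0 orbT.
- by rewrite -sn sE addKn.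
Qed.

(* Partitions of n as weakly decreasing sequences of positive parts, without
   trailing zeros. *)
Record intpart (n : nat) : predArgType :=
  IntPart { parts :> seq nat; _ : is_part_of_nat n parts }.

HB.instance Definition _ n := [isSub for @parts n].
HB.instance Definition _ n := [Countable of intpart n by <:].

Definition intpart_enum n : seq (intpart n) :=
  undup (pmap insub (parts_bounded n n)).

Lemma intpart_enumP n : Finite.axiom (intpart_enum n).
Proof.
move=> la; rewrite count_uniq_mem ?undup_uniq // mem_undup mem_pmap_sub.
rewrite mem_parts_bounded //; first exact: (valP la).
apply/allP=> x xl /=; case/and3P: (valP la) => _ _ /eqP <-.
by rewrite sumnE (big_rem x xl) leq_addr.
Qed.

HB.instance Definition _ n := isFinite.Build (intpart n) (@intpart_enumP n).

Definition conj_part (la : seq nat) : seq nat :=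
  [seq count (fun a => j < a) la | j <- iota 0 (head 0 la)].

Definition bin2_part (nu : seq nat) : nat := \sum_(a <- nu) 'C(a, 2).

End Partitions.

Section Tableaux.
Local Open Scope nat_scope.

(* A tableau is the sequence of its rows, from top to bottom (English
   notation); its shape is [shape T]. *)
Implicit Types (T : seq (seq nat)) (la mu : seq nat).

Definition column T (j : nat) : seq nat := [seq nth 0 r j | r <- T & j < size r].

Definition semistandard T : bool :=
  [&& 0 \notin flatten T, all (sorted leq) T
    & all (fun j => sorted ltn (column T j)) (iota 0 (head 0 (shape T)))].

(* Number of entries equal to 1, 2, ..., up to the largest entry of T. *)
Definition content T : seq nat :=
  [seq count_mem i.+1 (flatten T) | i <- iota 0 (\max_(x <- flatten T) x)].

Definition row_word T : seq nat := flatten (rev T).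

Definition word_inv (w : seq nat) : nat :=
  #|[set p : 'I_(size w) * 'I_(size w) |
      (p.1 < p.2) && (nth 0 w p.2 < nth 0 w p.1)]|.

Definition tableau_sign T : int := ((-1) ^+ word_inv (row_word T))%R.

Definition content_word mu : seq nat :=
  flatten [seq nseq (nth 0 mu i) i.+1 | i <- iota 0 (size mu)].

(* The semistandard tableaux of shape la and content mu, without repetition:
   see [mem_tableaux] and [uniq_tableaux]. *)
Definition tableaux la mu : seq (seq (seq nat)) :=
  undup [seq T <- [seq reshape la w | w <- permutations (content_word mu)]
        | [&& semistandard T, shape T == la & content T == mu]].

Lemma uniq_tableaux la mu : uniq (tableaux la mu).
Proof. exact: undup_uniq. Qed.

Lemma perm_content_word (w : seq nat) (M : nat) :
  0 \notin w -> all (geq M) w ->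
  perm_eq w (flatten [seq nseq (count_mem i.+1 w) i.+1 | i <- iota 0 M]).
Proof.
move=> w0 wM; apply/seq.permP=> P; rewrite count_flatten -map_comp.
rewrite (eq_map (_ : _ =1 fun i => (P i.+1 * count_mem i.+1 w))); last first.
  by move=> i /=; rewrite count_nseq.
elim: w w0 wM => [|a w IH] /=.
  by elim: (iota 0 M) => /= [|i s <-]; rewrite ?muln0.
rewrite inE negb_or => /andP[a0 w0] /andP[aM wM]; rewrite {}IH //.
case: a a0 aM => // a _ aM; rewrite !sumnE !big_map.
rewrite [RHS](eq_bigr (fun i => P i.+1 * (a.+1 == i.+1) + P i.+1 * count_mem i.+1 w));
  last by move=> i _; rewrite mulnDr.
rewrite big_split /=; congr (_ + _).
rewrite (bigD1_seq a) ?mem_iota ?iota_uniq //= eqxx muln1 big1 ?addn0 //.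
by move=> i; rewrite eqSS eq_sym => /negPf ->; rewrite muln0.
Qed.

Lemma mem_tableaux la mu T :
  (T \in tableaux la mu) = [&& semistandard T, shape T == la & content T == mu].
Proof.
rewrite mem_undup mem_filter andb_idr // => /and3P[/and3P[pT _ _] /eqP sT /eqP cT].
apply/mapP; exists (flatten T); last by rewrite -sT flattenK.
rewrite mem_permutations -{}cT {sT} /content_word size_map size_iota.
suff -> : [seq nseq (nth 0 (content T) i) i.+1
          | i <- iota 0 (\max_(x <- flatten T) x)] =
          [seq nseq (count_mem i.+1 (flatten T)) i.+1
          | i <- iota 0 (\max_(x <- flatten T) x)].
  apply: perm_content_word => //; apply/allP=> x xT /=.
  by rewrite (leq_bigmax_seq (F := id)).
apply/eq_in_map => i; rewrite mem_iota /= add0n => iM.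
by rewrite /content (nth_map 0) ?size_iota // nth_iota.
Qed.

(* The unique semistandard tableau with shape and content la. *)
Definition canonical_tableau la : seq (seq nat) := head [::] (tableaux la la).

Definition odd_kostka la mu : int :=
  (tableau_sign (canonical_tableau la) *
   \sum_(T <- tableaux la mu) tableau_sign T)%R.

End Tableaux.

Section DoubleCosets.
Local Open Scope group_scope.

Definition simple_transp (n : nat) : {set 'S_n} :=
  [set tperm p.1 p.2 | p : 'I_n * 'I_n & p.2 == p.1.+1 :> nat].

Lemma gen_simple_transp n : <<simple_transp n>> = [set: 'S_n].
Proof.
case: n => [|m].
  by apply/setP=> w; rewrite inE (_ : w = 1) ?group1 //; apply/permP; case.
apply/eqP; rewrite eqEsubset subsetT -(gen_tperm (ord0 : 'I_m.+1)) gen_subG.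
apply/subsetP=> _ /imsetP[y _ ->].
case: y => y; elim: y => [|y IH] ly.
  by rewrite (_ : Ordinal ly = ord0) ?tperm1 ?group1 //; apply: val_inj.
have ly' : (y < m.+1)%N := ltnW ly.
have Sy : tperm (Ordinal ly') (Ordinal ly) \in simple_transp m.+1.
  by apply/imsetP; exists (Ordinal ly', Ordinal ly); rewrite ?inE.
have [y0|Ny] := eqVneq y 0%N.
  have -> : ord0 = Ordinal ly' by apply: val_inj; rewrite /= y0.
  exact: mem_gen.
have := groupJ (IH ly') (mem_gen Sy); rewrite tpermJ tpermL tpermD //.
Qed.

(* [simple_transp n ^+ k] is the set of products of k simple transpositions. *)
Lemma coxeter_word n (w : 'S_n) : exists k, w \in simple_transp n ^+ k.
Proof.
have: w \in <<simple_transp n>> by rewrite gen_simple_transp inE.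
case/gen_prodgP=> k [c Sc ->]; exists k; elim: k c Sc => [|k IH] c Sc.
  by rewrite big_ord0 expg0 inE.
by rewrite big_ord_recl expgS mem_mulg ?IH.
Qed.

Definition coxeter_length n (w : 'S_n) : nat := ex_minn (coxeter_word w).

(* S_{a_1} x ... x S_{a_k}: the permutations preserving each of the k
   consecutive blocks of sizes a_1, ..., a_k. *)
Definition young_subgroup (n : nat) (alpha : seq nat) : {set 'S_n} :=
  [set w : 'S_n | [forall i, reshape_index alpha (w i) == reshape_index alpha i]].

Definition double_cosets (n : nat) (beta alpha : seq nat) : {set {set 'S_n}} :=
  [set young_subgroup n beta :* w * young_subgroup n alpha | w : 'S_n].

Definition min_length n (c : {set 'S_n}) : nat :=
  coxeter_length [arg min_(w < fingroup.repr c in c) coxeter_length w].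

Lemma coxeter_lengthV n (w : 'S_n) : coxeter_length w^-1 = coxeter_length w.
Proof.
have invS j (v : 'S_n) : v \in simple_transp n ^+ j -> v^-1 \in simple_transp n ^+ j.
  elim: j v => [|j IH] v; first by rewrite !expg0 !inE => /eqP ->; rewrite invg1.
  rewrite {1}expgS expgSr => /mulsgP[x y xS yS ->]; rewrite invMg mem_mulg ?IH //.
  by case/imsetP: xS => p pS ->; rewrite tpermV; apply/imsetP; exists p.
rewrite /coxeter_length; case: ex_minnP => i wi mi; case: ex_minnP => j wj mj.
by apply/eqP; rewrite eqn_leq mi ?invS // mj // -[w]invgK invS.
Qed.

Lemma min_lengthP n (c : {set 'S_n}) w0 : w0 \in c ->
  (exists2 w, w \in c & min_length c = coxeter_length w) /\
  (forall w, w \in c -> min_length c <= coxeter_length w)%N.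
Proof.
move=> cw0; rewrite /min_length; case: arg_minnP; first exact: mem_repr cw0.
by move=> w cw minw; split=> //; exists w.
Qed.

Lemma min_lengthV n (c : {set 'S_n}) : min_length c^-1 = min_length c.
Proof.
have [->|[w0 cw0]] := set_0Vmem c.
  by congr min_length; apply/setP=> w; rewrite !inE.
have c'w0 : w0^-1 \in c^-1 by rewrite memV_invg.
have [[w cw wE] minw] := min_lengthP cw0.
have [[v cv vE] minv] := min_lengthP c'w0.
apply/eqP; rewrite eqn_leq {1}wE {2}vE -(coxeter_lengthV w) -(coxeter_lengthV v).
by rewrite minv ?memV_invg // minw // -mem_invg.
Qed.

Lemma young_subgroupV n alpha : (young_subgroup n alpha)^-1 = young_subgroup n alpha.
Proof.
apply/setP=> w; rewrite !inE.
by apply/forallP/forallP=> wY i;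
  [have := wY (w i) | have := wY (w^-1 i)]; rewrite ?permK ?permKV eq_sym.
Qed.

Lemma mem_double_cosetsV n beta alpha (c : {set 'S_n}) :
  (c^-1 \in double_cosets n beta alpha) = (c \in double_cosets n alpha beta).
Proof.
have half b a d : d \in double_cosets n b a -> d^-1 \in double_cosets n a b.
  case/imsetP=> w _ ->; apply/imsetP; exists w^-1; rewrite ?inE //.
  by rewrite !invMg !young_subgroupV invg_set1 mulgA.
by apply/idP/idP=> /half; rewrite ?invgK.
Qed.

End DoubleCosets.

Section OddSymmetricFunctions.
Variable k : comNzRingType.

(* Letter i of a word stands for the generator h_(i+1). *)
Definition free_hsym : Type := {malg k[{fmonom nat}]}.
HB.instance Definition _ := GRing.Lmodule.on free_hsym.
HB.instance Definition _ := GRing.NzRing.on free_hsym.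

Definition hgen (n : nat) : free_hsym := if n is i.+1 then << fmu i >> else 1.

Definition hprod (alpha : seq nat) : free_hsym := \prod_(a <- alpha) hgen a.

Definition comp_of_word (u : {fmonom nat}) : seq nat := [seq i.+1 | i <- u].

Definition hform_coef (beta alpha : seq nat) : k :=
  if sumn beta == sumn alpha then
    \sum_(c in double_cosets (sumn alpha) beta alpha) (-1) ^+ min_length c
  else 0.

Definition hform (x y : free_hsym) : k :=
  \sum_(u <- msupp x) \sum_(v <- msupp y)
    x@_u * y@_v * hform_coef (comp_of_word u) (comp_of_word v).

Lemma hform_widen (d : {fset {fmonom nat}}) (x y : free_hsym) :
  (msupp x `<=` d)%fset ->
  hform x y = \sum_(u <- d) \sum_(v <- msupp y)
    x@_u * y@_v * hform_coef (comp_of_word u) (comp_of_word v).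
Proof.
move=> sxd; apply: big_fset_incl => // u _ ux; apply: big1 => v _.
by rewrite mcoeff_outdom // !mul0r.
Qed.

Lemma hform_linearl (c : k) (x1 x2 y : free_hsym) :
  hform (c *: x1 + x2) y = c * hform x1 y + hform x2 y.
Proof.
pose d := (msupp (c *: x1 + x2) `|` msupp x1 `|` msupp x2)%fset.
rewrite !(@hform_widen d) ?fsubsetUr //; last first.
- by rewrite /d -fsetUA fsubsetUl.
- by rewrite /d fsetUAC fsubsetUr.
rewrite big_distrr -big_split /=; apply: eq_bigr => u _.
rewrite big_distrr -big_split /=; apply: eq_bigr => v _.
by rewrite mcoeffD mcoeffZ !mulrDl !mulrA.
Qed.

Lemma hform_coefC beta alpha : hform_coef beta alpha = hform_coef alpha beta.
Proof.
rewrite /hform_coef eq_sym; case: eqP => // ->.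
rewrite (reindex_inj invg_inj) /=; apply: eq_big => c.
  exact: mem_double_cosetsV.
by rewrite min_lengthV.
Qed.

Lemma hformC (x y : free_hsym) : hform x y = hform y x.
Proof.
rewrite /hform exchange_big; apply: eq_bigr => u _; apply: eq_bigr => v _.
by rewrite hform_coefC [_@__ * _]mulrC.
Qed.

Definition hradical (x : free_hsym) : bool := `[< forall y, hform x y = 0 >].

Lemma hradical_submod : submod_closed hradical.
Proof.
have h0 y : hform 0 y = 0.
  by have := hform_linearl (-1) 0 0 y; rewrite scaler0 addr0 mulN1r addNr.
split=> [|c x1 x2 /asboolP I1 /asboolP I2]; first exact/asboolP.
by apply/asboolP=> y; rewrite hform_linearl I1 I2 mulr0 addr0.
Qed.

HB.instance Definition _ :=
  GRing.isSubmodClosed.Build k free_hsym hradical hradical_submod.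

Definition hradical_closed : zmodClosed free_hsym :=
  GRing.ZmodClosed.clone free_hsym hradical _.

Definition odd_sym : Type := {ideal_quot hradical_closed}.
HB.instance Definition _ := Choice.on odd_sym.
HB.instance Definition _ := GRing.Zmodule.on odd_sym.

Local Open Scope quotient_scope.

Definition to_odd_sym (x : free_hsym) : odd_sym := \pi_({ideal_quot hradical_closed}) x.

Definition lift_hsym (x : odd_sym) : free_hsym := repr (x : {ideal_quot hradical_closed}).

Lemma lift_hsymK : cancel lift_hsym to_odd_sym.
Proof. exact: reprK. Qed.

Lemma to_odd_symP (x y : free_hsym) :
  reflect (to_odd_sym x = to_odd_sym y) (x - y \in hradical_closed).
Proof. by rewrite Quotient.idealrBE; apply: eqP. Qed.

Lemma to_odd_symD : {morph to_odd_sym : x y / x + y}.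
Proof. exact: Quotient.pi_add. Qed.

Definition odd_sym_scale (c : k) (x : odd_sym) : odd_sym :=
  to_odd_sym (c *: lift_hsym x).

Lemma odd_sym_scale_pi c x :
  odd_sym_scale c (to_odd_sym x) = to_odd_sym (c *: x).
Proof.
apply/to_odd_symP; rewrite -scalerBr; apply: rpredZ.
by apply/to_odd_symP; rewrite lift_hsymK.
Qed.

Lemma odd_sym_scaleA a b x :
  odd_sym_scale a (odd_sym_scale b x) = odd_sym_scale (a * b) x.
Proof. by rewrite odd_sym_scale_pi scalerA. Qed.

Lemma odd_sym_scale1 : left_id 1 odd_sym_scale.
Proof. by move=> x; rewrite /odd_sym_scale scale1r lift_hsymK. Qed.

Lemma odd_sym_scaleDr : right_distributive odd_sym_scale +%R.
Proof.
move=> c x y; rewrite -[x]lift_hsymK -[y]lift_hsymK -to_odd_symD.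
by rewrite !odd_sym_scale_pi scalerDr to_odd_symD.
Qed.

Lemma odd_sym_scaleDl x : {morph odd_sym_scale^~ x : a b / a + b}.
Proof. by move=> a b; rewrite /odd_sym_scale scalerDl to_odd_symD. Qed.

HB.instance Definition _ := GRing.Zmodule_isLmodule.Build k odd_sym
  odd_sym_scaleA odd_sym_scale1 odd_sym_scaleDr odd_sym_scaleDl.

(* The form induced on the quotient, see [odd_form_pi]. *)
Definition odd_form (x y : odd_sym) : k := hform (lift_hsym x) (lift_hsym y).

Lemma odd_form_pi x y : odd_form (to_odd_sym x) (to_odd_sym y) = hform x y.
Proof.
have form_eql x1 x2 z : to_odd_sym x1 = to_odd_sym x2 -> hform x1 z = hform x2 z.
  move/to_odd_symP/asboolP/(_ z) => /(congr1 (+%R^~ (hform x2 z))).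
  by rewrite add0r => <-; rewrite -[in LHS](subrK x2 x1) -[x1 - x2]scale1r
     hform_linearl mul1r scale1r.
rewrite /odd_form (form_eql _ x) ?lift_hsymK // hformC (form_eql _ y) ?lift_hsymK //.
exact: hformC.
Qed.

Definition homogeneous (n : nat) (x : free_hsym) : Prop :=
  forall u, u \in msupp x -> sumn (comp_of_word u) = n.

Definition odd_sym_deg (n : nat) (x : odd_sym) : Prop :=
  exists2 y, homogeneous n y & x = to_odd_sym y.

Definition h_part n (la : intpart n) : odd_sym := to_odd_sym (hprod la).

Definition is_odd_monomial n (m : intpart n -> odd_sym) : Prop :=
  (forall mu, odd_sym_deg n (m mu)) /\
  (forall la mu, odd_form (h_part la) (m mu) = (la == mu)%:R).

Definition is_odd_schur n (s : intpart n -> odd_sym) : Prop :=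
  (forall la, odd_sym_deg n (s la)) /\
  (forall mu : intpart n, h_part mu = \sum_(la : intpart n) (odd_kostka la mu)%:~R *: s la).

End OddSymmetricFunctions.

(* Main.v *)
(* For compositions [al], [be] of [n] write [K la al] for the signed count of tableaux of shape
   [la] and content [al], and [eps la = (-1) ^ binom(la^T, 2) = (-1) ^ (sum_i i * la_i)], rows
   being numbered from 0. Everything follows from the odd Cauchy identity
     (h_be, h_al) = sum_la eps la * K la be * K la al                        (1)
   for all compositions. As [K] restricted to partitions is unitriangular for dominance, (1)
   forces (s_la, h_be) = eps la * K la be, hence h_al = sum_la K la al s_la for every composition
   [al], since both sides pair equally with all h_be and the form on the quotient is
   nondegenerate. So an element of degree n orthogonal to all h_mu, mu a partition, vanishes, and
   the two sides of the theorem have the same pairings with the h_mu.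

   For (1), peel off the largest letter: [K (al, a) nu] is a sum over horizontal strips [nu / la]
   of size [a] with sign (-1) ^ (sum_(s < r) la_s (nu_r - la_r)). With U_a the operator adding
   such strips and D_b = eps U_b^T eps, Fomin's local rule
     nu_(s+1) + kappa_s = min(la_s, mu_s) + max(la_(s+1), mu_(s+1))
   is compatible with signs and yields
     D_b U_a = sum_i (-1) ^ ((a - i)(b - i)) U_(a-i) D_(b-i).
   Moving D_b through all the U's gives the recursion in the last part of [be] that is also
   satisfied by the signed count of words of content [al] sorted on the blocks of [be]; these
   words encode the minimal length double coset representatives. *)

Require Import Defs.
From mathcomp Require Import all_boot all_fingroup all_algebra.
From mathcomp Require Import finmap monalg boolp.
From mathcomp Require Import zify ring.
Set Implicit Arguments.
Unset Strict Implicit.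
Unset Printing Implicit Defensive.
Import GRing.Theory.
Local Open Scope ring_scope.

(** * Horizontal strips and the local rule *)

Section HStrips.
Local Open Scope nat_scope.
Variable n : nat.

(* Every partition of size at most [n], padded with zeros, is a box, so that sums over
   partitions range over a finite type. *)
Definition box := n.+1.-tuple 'I_n.+1.
Definition bval (p : box) (i : nat) : nat := nth 0 (map val p) i.
Definition bsize (p : box) : nat := \sum_(i < n.+1) bval p i.
Definition bpre (p : box) (j : nat) : nat := \sum_(i < j) bval p i.
(** [inord] sends values above [n] to 0, so [f] is recovered only where it is bounded by [n]. *)
Definition mkbox (f : nat -> nat) : box := [tuple inord (f i) | i < n.+1].

Definition hstrip (la nu : box) : bool :=
  [forall i : 'I_n.+1, (bval la i <= bval nu i) && (bval nu i.+1 <= bval la i)].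

(* Modulo 2, [bval nu r + bval la r] is the number of new cells in row [r]. *)
Definition strip_exp (la nu : box) : nat :=
  \sum_(r < n.+1) bpre la r * (bval nu r + bval la r).

Definition row_exp (p : box) : nat := \sum_(i < n.+1) i * bval p i.

Lemma bval_out p i : n < i -> bval p i = 0.
Proof. by move=> ni; rewrite /bval nth_default // size_map size_tuple. Qed.

Lemma bval_ub p i : bval p i <= n.
Proof.
case: (ltnP i n.+1) => iN; last by rewrite bval_out.
by rewrite /bval (nth_map ord0) ?size_tuple // -ltnS; apply: ltn_ord.
Qed.

Lemma bval_mkbox f i : i <= n -> f i <= n -> bval (mkbox f) i = f i.
Proof.
move=> ni fi; rewrite /bval (nth_map ord0) ?size_tuple //.
have -> : i = Ordinal (ni : i < n.+1) by [].
by rewrite -tnth_nth tnth_mktuple /= inordK.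
Qed.

Lemma eq_box (p q : box) : (forall i, i <= n -> bval p i = bval q i) -> p = q.
Proof.
move=> pq; apply/eq_from_tnth => i; apply/val_inj.
have := pq i (ltn_ord i); rewrite /bval !(nth_map ord0) ?size_tuple //.
by rewrite -!tnth_nth.
Qed.

Lemma hstripP la nu :
  reflect (forall i, bval la i <= bval nu i /\ bval nu i.+1 <= bval la i) (hstrip la nu).
Proof.
apply: (iffP forallP) => [H i|H i]; last by apply/andP; apply: H.
case: (leqP i n) => ni; last by rewrite !bval_out // ltnW.
by have /andP := H (Ordinal (ni : i < n.+1)).
Qed.

Lemma bpreS p j : bpre p j.+1 = bpre p j + bval p j.
Proof. by rewrite /bpre big_ord_recr. Qed.

Lemma bpre0 p : bpre p 0 = 0. Proof. by rewrite /bpre big_ord0. Qed.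

Lemma bpre_le p j : bpre p j <= bsize p.
Proof.
rewrite /bpre /bsize -!(big_mkord xpredT (bval p)).
case: (leqP j n.+1) => jn; first by rewrite [leqRHS](big_cat_nat _ jn) //= leq_addr.
rewrite (big_cat_nat _ (ltnW jn)) //= (_ : \sum_(n.+1 <= i < j) _ = 0) ?addn0 //.
by rewrite big_nat_cond big1 // => i; rewrite andbT => /andP[ni _]; rewrite bval_out.
Qed.

Lemma bval_le p i : bval p i <= bsize p.
Proof. by apply: leq_trans (bpre_le p i.+1); rewrite bpreS leq_addl. Qed.

(** A nonzero part at index [i] makes all parts up to [i] positive, so the size would be at least
    [i.+1]. *)
Lemma bval_decr_zero p i : (forall j, bval p j.+1 <= bval p j) ->
  bsize p <= i -> bval p i = 0.
Proof.
move=> dp si; case E: (bval p i) => [//|v].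
have H j : j <= i -> 0 < bval p (i - j).
  elim: j => [|j IH] ji; first by rewrite subn0 E.
  apply: leq_trans (IH (ltnW ji)) _.
  by rewrite -(subnSK ji); apply: dp.
have H2 j : j <= i.+1 -> j <= bpre p j.
  elim: j => // j IH ji; rewrite bpreS.
  have := H (i - j) (leq_subr _ _); rewrite subKn // => ?.
  by have := IH (ltnW ji); lia.
by have := H2 i.+1 (leqnn _); have := bpre_le p i.+1; lia.
Qed.

Lemma hstrip_decrl la nu i : hstrip la nu -> bval la i.+1 <= bval la i.
Proof. by move/hstripP=> H; have := H i; have := H i.+1; lia. Qed.

Lemma hstrip_decrr la nu i : hstrip la nu -> bval nu i.+1 <= bval nu i.
Proof. by move/hstripP=> H; have := H i; lia. Qed.

Lemma hstrip_size la nu : hstrip la nu -> bsize la <= bsize nu.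
Proof. by move/hstripP=> H; apply: leq_sum => i _; case: (H i). Qed.

Lemma big_nat_shift (f : nat -> nat) N :
  \sum_(i < N) f i.+1 + f 0 = \sum_(i < N) f i + f N.
Proof.
transitivity (\sum_(i < N.+1) f i); last by rewrite big_ord_recr.
by rewrite big_ord_recl addnC.
Qed.

(* By induction on [N]; the right-hand side is a boundary term that vanishes once [l] and [m]
   do. *)
Lemma reflect_parity (l m v k : nat -> nat) N :
  (forall s, s < N ->
     v s.+1 + k s = minn (l s) (m s) + maxn (l s.+1) (m s.+1)) ->
  let pre (f : nat -> nat) r := \sum_(s < r) f s in
  odd (\sum_(r < N.+1) (r + pre l r + pre m r) * v r
       + \sum_(r < N) (pre l r * l r + pre m r * m r + r * (l r + m r))
       + \sum_(r < N) (r * k r + pre k r * (l r + m r))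
       + (pre l N + pre k N) * (pre m N + pre k N))
  = odd ((N + pre l N + pre m N) * maxn (l N) (m N)).
Proof.
move=> Hv pre; elim: N Hv => [|N IH] Hv.
  by rewrite big_ord_recl !big_ord0 /= /pre !big_ord0.
have {}IH := IH (fun s sN => Hv s (ltnW sN)).
have {Hv} /(congr1 odd) := Hv N (ltnSn N).
rewrite [\sum_(r < N.+2) _]big_ord_recr [\sum_(r < N.+1) (pre l _ * l _ + _ + _)]big_ord_recr.
rewrite [\sum_(r < N.+1) (_ * k _ + _)]big_ord_recr /=.
have preS f : pre f N.+1 = pre f N + f N by rewrite /pre big_ord_recr.
rewrite !preS; move: IH.
(* Modulo 2, minimum and maximum at [N] enter only through these two facts: their sum is
   [l N + m N], and the maximum is one of the two values. What remains is a finite Boolean check. *)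
have Emin : odd (minn (l N) (m N)) = odd (maxn (l N) (m N)) (+) odd (l N) (+) odd (m N).
  by case: leqP => _; case: (odd _); case: (odd _).
have Emax : (odd (maxn (l N) (m N)) == odd (l N)) || (odd (maxn (l N) (m N)) == odd (m N)).
  by case: leqP => _; rewrite eqxx ?orbT.
rewrite /= !(oddD, oddM, oddS) {}Emin; move: Emax.
move: (odd (maxn (l N) (m N))) (odd (maxn (l N.+1) (m N.+1))) => x x'.
set A := odd (\sum_(r < _) _); set B := odd (\sum_(r < _) _).
set C := odd (\sum_(r < _) _).
move: A B C (odd (v N.+1)) (odd (k N)) (odd (l N)) (odd (m N)) => A B C vN kN lN mN.
move: (odd (pre l N)) (odd (pre m N)) (odd (pre k N)) (odd N) => L M K o.
move=> Ex /(canRL (addbK _)) /(canRL (addbK _)) /(canRL (addbK _)) -> /(canRL (addbK _)) ->.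
move: Ex; case: x; case: lN; case: mN => //= _; case: x'; case: L; case: M;
  case: K; case: o; case: kN; case: B; case: C; reflexivity.
Qed.

(** This is [reflect_parity] at [N = n.+1]. Parts out of range vanish, which kills the boundary
    term, and the remaining sums regroup modulo 2 into sizes, row exponents and strip exponents. *)
Lemma strip_exp_parity (la mu nu ka : box) :
  (forall s, s < n.+1 -> bval nu s.+1 + bval ka s
     = minn (bval la s) (bval mu s) + maxn (bval la s.+1) (bval mu s.+1)) ->
  odd (row_exp nu + row_exp mu + strip_exp la nu + strip_exp mu nu)
  = odd ((bsize mu + bsize ka) * (bsize la + bsize ka)
         + row_exp ka + row_exp la + strip_exp ka la + strip_exp ka mu).
Proof.
move/reflect_parity => /=; rewrite !(bval_out _ (ltnSn n)) maxnn muln0 /=.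
rewrite big_ord_recr /= bval_out // muln0 addn0.
under eq_bigr => r _ do rewrite !mulnDl.
rewrite /strip_exp /row_exp.
under [\sum_(i < n.+1) (_ + _ + _ * (_ + _))]eq_bigr => r _ do rewrite mulnDr.
under [\sum_(i < n.+1) (_ + _ * (_ + _))]eq_bigr => r _ do rewrite mulnDr.
under [\sum_(r < n.+1) bpre la r * (bval nu r + _)]eq_bigr => r _ do rewrite mulnDr.
under [\sum_(r < n.+1) bpre mu r * (bval nu r + _)]eq_bigr => r _ do rewrite mulnDr.
under [\sum_(r < n.+1) bpre ka r * (bval la r + _)]eq_bigr => r _ do rewrite mulnDr.
under [\sum_(r < n.+1) bpre ka r * (bval mu r + _)]eq_bigr => r _ do rewrite mulnDr.
rewrite !big_split /= !oddD.
rewrite (mulnC (bsize mu + _)) -!/(bsize _).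
rewrite /bpre; do 5![move/(canRL (addbK _))] => ->; move: (odd (_ * _)) => z.
do 10![move: (odd (\sum_(i < n.+1) _)) => ?].
do ![match goal with x : bool |- _ => is_var x; case: x end].
all: reflexivity.
Qed.

(** Sum of the local rule over all rows, using min + max = sum of both. The terms shifted to [s.+1]
    miss row 0, which accounts for the first parts in the formula. *)
Lemma reflect_size (la mu nu ka : box) :
  (forall s, s < n.+1 -> bval nu s.+1 + bval ka s
     = minn (bval la s) (bval mu s) + maxn (bval la s.+1) (bval mu s.+1)) ->
  bsize nu + bsize ka + maxn (bval la 0) (bval mu 0)
  = bsize la + bsize mu + bval nu 0.
Proof.
move=> H.
have E : \sum_(i < n.+1) (bval nu i.+1 + bval ka i) =
  \sum_(i < n.+1) (minn (bval la i) (bval mu i) + maxn (bval la i.+1) (bval mu i.+1)).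
  by apply: eq_bigr => i _; apply: H.
rewrite !big_split /= in E.
have := big_nat_shift (bval nu) n.+1.
have := big_nat_shift (fun i => maxn (bval la i) (bval mu i)) n.+1.
rewrite /= !(bval_out _ (ltnSn n)) maxnn.
have : \sum_(i < n.+1) minn (bval la i) (bval mu i) +
       \sum_(i < n.+1) maxn (bval la i) (bval mu i) = bsize la + bsize mu.
  rewrite /bsize -!big_split; apply: eq_bigr => i _ /=.
  by case: leqP => _; rewrite // addnC.
move: E.
(* With every big sum replaced by a variable, only linear arithmetic is left. *)
have aux (V' K M' X' X LM x0 V v0 : nat) : V' + K = M' + X' -> M' + X = LM ->
  X' + x0 = X + 0 -> V' + v0 = V + 0 -> V + K + x0 = LM + v0 by lia.
exact: aux.
Qed.

(* The local rule determines [ka] from [nu], and all of [nu] but its first part from [ka]; the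
   first part of [nu] is fixed by the sizes. *)
Definition reflect_down (la mu nu : box) : box :=
  mkbox (fun s => minn (bval la s) (bval mu s) + maxn (bval la s.+1) (bval mu s.+1)
                  - bval nu s.+1).

(** The first part is [reflect_size] solved for [bval nu 0], with [bsize nu - bsize la = a]. *)
Definition reflect_up (a : nat) (la mu ka : box) : box :=
  mkbox (fun s => if s is s'.+1 then
      minn (bval la s') (bval mu s') + maxn (bval la s) (bval mu s) - bval ka s'
    else maxn (bval la 0) (bval mu 0) + bsize ka + a - bsize mu).

(** [mkbox] does not clip here: the strip conditions bound [bval nu s.+1] from below by the maximum,
    so the value is at most [bval la s]. *)
Lemma reflect_downE la mu nu : hstrip la nu -> hstrip mu nu ->
  forall s, bval (reflect_down la mu nu) s =
    minn (bval la s) (bval mu s) + maxn (bval la s.+1) (bval mu s.+1) - bval nu s.+1.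
Proof.
move=> /hstripP H1 /hstripP H2 s; case: (leqP s n) => sn; last first.
  by rewrite !bval_out // leqW.
rewrite bval_mkbox //; have := H1 s; have := H2 s; have := H1 s.+1; have := H2 s.+1.
have := bval_ub la s; lia.
Qed.

(** The strip conditions place [bval nu s.+1] between the maximum of row [s.+1] and the minimum of
    row [s] of [la] and [mu]. The local rule reflects it in this interval, so [ka] obeys the same
    bounds, which are the strip conditions below [la] and [mu]. The size bound expresses that the
    first part of [nu] is at least those of [la] and [mu]. *)
Lemma reflect_downP la mu nu a b : hstrip la nu -> hstrip mu nu ->
  bsize la + a = bsize nu -> bsize mu + b = bsize nu ->
  let ka := reflect_down la mu nu in
  [/\ hstrip ka la, hstrip ka mu, bsize la <= bsize ka + b,
      reflect_up a la mu ka = nu &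
      forall s, s < n.+1 -> bval nu s.+1 + bval ka s
        = minn (bval la s) (bval mu s) + maxn (bval la s.+1) (bval mu s.+1)].
Proof.
move=> H1 H2 Sa Sb ka; have E := reflect_downE H1 H2; rewrite -/ka in E.
move/hstripP in H1; move/hstripP in H2.
have R s : s < n.+1 -> bval nu s.+1 + bval ka s
        = minn (bval la s) (bval mu s) + maxn (bval la s.+1) (bval mu s.+1).
  move=> _; rewrite E; have := H1 s; have := H2 s; have := H1 s.+1; have := H2 s.+1; lia.
have S := reflect_size R.
split=> //.
- apply/hstripP=> i; rewrite E.
  by have := H1 i; have := H2 i; have := H1 i.+1; have := H2 i.+1; lia.
- apply/hstripP=> i; rewrite E.
  by have := H1 i; have := H2 i; have := H1 i.+1; have := H2 i.+1; lia.
- by have := H1 0; have := H2 0; lia.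
apply: eq_box => i ni.
have ub := bval_ub nu i.
have Ei : (if i is s'.+1 then
      minn (bval la s') (bval mu s') + maxn (bval la i) (bval mu i) - bval ka s'
    else maxn (bval la 0) (bval mu 0) + bsize ka + a - bsize mu) = bval nu i.
  case: i {ub} ni => [|i] ni; first by lia.
  by have := R i (ltnW ni); lia.
by rewrite bval_mkbox ?Ei.
Qed.

(** The same reflection backwards; the bound [bsize la + a <= n] makes [nu] fit into a box. *)
Lemma reflect_upP la mu ka a b : hstrip ka la -> hstrip ka mu ->
  bsize la <= bsize ka + b -> bsize la + a = bsize mu + b -> bsize la + a <= n ->
  let nu := reflect_up a la mu ka in
  [/\ hstrip la nu, hstrip mu nu, bsize la + a = bsize nu & reflect_down la mu nu = ka].
Proof.
move=> H1 H2 Sk Sab Sn nu.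
(* Row [n] of [la] and [mu] is empty, so the rule asks for nothing in row [n.+1] of [nu], which lies
   outside the box. *)
have zl i : n <= i -> bval la i = 0.
  move=> ni; apply: bval_decr_zero => [j|]; first exact: hstrip_decrr H1.
  lia.
have zm i : n <= i -> bval mu i = 0.
  move=> ni; apply: bval_decr_zero => [j|]; first exact: hstrip_decrr H2.
  lia.
move/hstripP in H1; move/hstripP in H2.
have Ek s : maxn (bval la s.+1) (bval mu s.+1) <= bval ka s <= minn (bval la s) (bval mu s).
  by have := H1 s; have := H2 s; lia.
have lb s := bval_ub la s.
have ES s : bval nu s.+1 = minn (bval la s) (bval mu s) + maxn (bval la s.+1) (bval mu s.+1)
  - bval ka s.
  case: (leqP n s) => sn; first by rewrite bval_out // zl // min0n !zl 1?ltnW // !zm 1?ltnW.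
  by rewrite bval_mkbox //; have := Ek s; have := lb s; lia.
have R s : s < n.+1 -> bval nu s.+1 + bval ka s
        = minn (bval la s) (bval mu s) + maxn (bval la s.+1) (bval mu s.+1).
  by move=> _; rewrite ES; have := Ek s; lia.
have S := reflect_size R.
have T : \sum_(i < n.+1) (bval nu i.+1 + bval ka i) =
  \sum_(i < n.+1) (minn (bval la i) (bval mu i) + maxn (bval la i.+1) (bval mu i.+1)).
  by apply: eq_bigr => i _; apply: R.
(* The local rule summed over the rows bounds this first part by [bsize la + a], so it is not
   clipped. *)
have E0 : bval nu 0 = maxn (bval la 0) (bval mu 0) + bsize ka + a - bsize mu.
  rewrite bval_mkbox //.
  have := big_nat_shift (fun i => maxn (bval la i) (bval mu i)) n.+1.
  rewrite /= !(bval_out _ (ltnSn n)) maxnn addn0.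
  have : \sum_(i < n.+1) minn (bval la i) (bval mu i) +
         \sum_(i < n.+1) maxn (bval la i) (bval mu i) = bsize la + bsize mu.
    rewrite /bsize -!big_split; apply: eq_bigr => i _ /=.
    by case: leqP => _; rewrite // addnC.
  have aux (V' K M' X' X L M x0 : nat) : V' + K = M' + X' -> M' + X = L + M ->
    X' + x0 = X -> L + a <= n -> x0 + K + a - M <= n by lia.
  move: T Sn; rewrite !big_split /= => T Sn E1 E2; exact: (aux _ _ _ _ _ _ _ _ T E1 E2 Sn).
split.
- apply/hstripP=> -[|i]; rewrite !ES ?E0; last by have := Ek i; have := Ek i.+1; lia.
  by have := Ek 0; lia.
- apply/hstripP=> -[|i]; rewrite !ES ?E0; last by have := Ek i; have := Ek i.+1; lia.
  by have := Ek 0; lia.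
- lia.
apply: eq_box => i ni; rewrite bval_mkbox ?ES //; have := Ek i; have := lb i; lia.
Qed.

Local Open Scope ring_scope.

(** The matrix entry at [(la, mu)] of D_b U_a = sum_i (-1) ^ ((a - i)(b - i)) U_(a-i) D_(b-i). A
    shape [ka] determines [i] by [bsize la - bsize ka = b - i], and the third condition on the right
    says that this [i] is not negative. The maps [reflect_up] and [reflect_down] match the two index
    sets, [strip_exp_parity] the signs. *)
Lemma hstrip_local_rule (la mu : box) a b : (bsize la + a <= n)%N ->
  \sum_(nu | (hstrip la nu && (bsize la + a == bsize nu)%N) &&
             (hstrip mu nu && (bsize mu + b == bsize nu)%N))
     (-1) ^+ (row_exp nu + row_exp mu + strip_exp la nu + strip_exp mu nu) =
  \sum_(ka | [&& hstrip ka la, hstrip ka mu, (bsize la <= bsize ka + b)%N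
              & (bsize la + a == bsize mu + b)%N])
     (-1) ^+ ((bsize mu + bsize ka) * (bsize la + bsize ka) + row_exp ka + row_exp la
              + strip_exp ka la + strip_exp ka mu) :> int.
Proof.
move=> lan.
rewrite (reindex_onto (reflect_up a la mu) (reflect_down la mu)) /=; last first.
  by move=> nu /andP[/andP[H1 /eqP S1] /andP[H2 /eqP S2]]; case: (reflect_downP H1 H2 S1 S2).
have P ka : [&& hstrip ka la, hstrip ka mu, (bsize la <= bsize ka + b)%N
              & (bsize la + a == bsize mu + b)%N] =
   ((hstrip la (reflect_up a la mu ka)
        && (bsize la + a == bsize (reflect_up a la mu ka))%N
        && (hstrip mu (reflect_up a la mu ka)
            && (bsize mu + b == bsize (reflect_up a la mu ka))%N)
        && (reflect_down la mu (reflect_up a la mu ka) == ka))).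
  apply/and4P/idP => [[H1 H2 H3 /eqP H4]|].
    have [-> -> S ->] := reflect_upP H1 H2 H3 H4 lan.
    by rewrite -H4 S !eqxx.
  case/andP=> /andP[/andP[H1 /eqP S1] /andP[H2 /eqP S2]] /eqP E.
  have := reflect_downP H1 H2 S1 S2; rewrite /= E => -[-> -> -> _ _].
  by rewrite S1 S2 eqxx.
apply/esym/eq_big => [//|ka]; rewrite P.
case/andP=> /andP[/andP[H1 /eqP S1] /andP[H2 /eqP S2]] /eqP E.
have := reflect_downP H1 H2 S1 S2; rewrite /= E => -[_ _ _ _ /strip_exp_parity par].
by rewrite -signr_odd -par signr_odd.
Qed.

End HStrips.

(** * Signed Kostka numbers by recursion on the content *)

Section Kostka.
Local Open Scope nat_scope.

Fixpoint subcomps (b : nat) (ra : seq nat) : seq (seq nat) :=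
  if ra is a :: ra' then
    flatten [seq [seq i :: io | io <- subcomps (b - i) ra'] | i <- iota 0 (minn a b).+1]
  else if b == 0 then [:: [::]] else [::].

Definition subw (ra io : seq nat) : seq nat := [seq p.1 - p.2 | p <- zip ra io].

(** The exponent accumulated while D_b passes the operators U_a, [io] being the amounts cancelled on
    the way: behind the head, [b - i = sumn io'] is still to be removed. *)
Fixpoint cross_exp (ra io : seq nat) : nat :=
  match ra, io with
  | a :: ra', i :: io' => (a - i) * sumn io' + cross_exp ra' io'
  | _, _ => 0
  end.

Lemma subcomps_cons b a ra : subcomps b (a :: ra) =
  flatten [seq [seq i :: io | io <- subcomps (b - i) ra] | i <- iota 0 (minn a b).+1].
Proof. by []. Qed.

Lemma mem_subcomps b ra io :
  (io \in subcomps b ra) = [&& size io == size ra, all2 leq io ra & sumn io == b].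
Proof.
elim: ra b io => [|a ra IH] b io; [rewrite /= | rewrite subcomps_cons].
  by case: eqP => [->|/eqP nb]; case: io => [|i io] //=; rewrite ?inE //;
     apply/esym/negbTE; rewrite eq_sym.
apply/flatten_mapP/idP => [[i]|].
  rewrite mem_iota add0n ltnS => /andP[_ im] /mapP[jo]; rewrite IH.
  case/and3P=> /eqP sj lj /eqP nj -> /=; rewrite eqSS sj eqxx lj /=.
  by rewrite nj; lia.
case: io => [|i io] //= /and3P[]; rewrite eqSS => si /andP[ia lio] /eqP nb.
exists i; first by rewrite -[_ :: _]/(iota 0 (minn a b).+1) mem_iota; lia.
by apply/mapP; exists io => //; rewrite IH si lio /=; lia.
Qed.

Lemma uniq_subcomps b ra : uniq (subcomps b ra).
Proof.
elim: ra b => [|a ra IH] b; first by rewrite /=; case: eqP.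
apply: (@allpairs_uniq_dep _ _ _ (fun i io => i :: io) (iota 0 (minn a b).+1)
  (fun i => subcomps (b - i) ra)).
- exact: iota_uniq.
- by move=> i _; apply: IH.
- by move=> [i io] [j jo] _ _ /= [-> ->].
Qed.

Lemma sumn_subw ra io : size io = size ra -> all2 leq io ra ->
  sumn (subw ra io) + sumn io = sumn ra.
Proof.
elim: ra io => [|a ra IH] [|i io] //= [sio] /andP[ia lio].
by have := IH io sio lio; rewrite -/(subw ra io); lia.
Qed.

Variable n : nat.
Local Open Scope ring_scope.

(* [ra] is the content read backwards: its head is the multiplicity of the largest letter. *)
Fixpoint kostka_rec (ra : seq nat) (nu : box n) : int :=
  if ra is a :: ra' then
    \sum_(la | hstrip la nu && (bsize la + a == bsize nu)%N)
       (-1) ^+ strip_exp la nu * kostka_rec ra' la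
  else (bsize nu == 0)%:R.

Lemma kostka_rec_cons a ra nu : kostka_rec (a :: ra) nu =
  \sum_(la | hstrip la nu && (bsize la + a == bsize nu)%N)
       (-1) ^+ strip_exp la nu * kostka_rec ra la.
Proof. by []. Qed.

Lemma kostka_rec_size ra nu : kostka_rec ra nu != 0 -> bsize nu = sumn ra.
Proof.
elim: ra nu => [|a ra IH] nu /=; first by case: (bsize nu =P 0%N) => // _; rewrite eqxx.
move=> H; apply/eqP; apply: contraNT H => ns.
apply/eqP/big1 => la /andP[_ /eqP E].
have [->|/IH] := eqVneq (kostka_rec ra la) 0; first by rewrite mulr0.
by move=> El; move: ns; rewrite -E El addnC eqxx.
Qed.

Lemma bsize0_inj (p q : box n) : bsize p = 0%N -> bsize q = 0%N -> p = q.
Proof.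
move=> p0 q0; apply: eq_box => i _.
by have := bval_le p i; have := bval_le q i; rewrite p0 q0; lia.
Qed.

(** The left-hand side is D_b applied to the vector that the operators U_a, for [a] in [ra], build
    from the empty shape. Induction on [ra]: D_b passes the outermost U_a and becomes D_(b-i); on
    the empty shape only D_0 survives. *)
Lemma kostka_rec_skew ra mu b : (sumn ra <= n)%N ->
  \sum_(nu | hstrip mu nu && (bsize mu + b == bsize nu)%N)
     (-1) ^+ (row_exp nu + row_exp mu + strip_exp mu nu) * kostka_rec ra nu =
  \sum_(io <- subcomps b ra) (-1) ^+ cross_exp ra io * kostka_rec (subw ra io) mu.
Proof.
elim: ra mu b => [|a ra IH] mu b ran; first rewrite /=.
  case: (eqVneq (bsize mu + b)%N 0%N) => [z|nz].
    have mu0 : bsize mu = 0%N by lia.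
    have b0 : b = 0%N by lia.
    rewrite b0 /= big_seq1 /= mu0 mul1r (big_pred1 mu) /= => [|nu /=]; last first.
      apply/andP/eqP => [[_ /eqP /esym nu0]|->]; first exact: bsize0_inj.
      rewrite mu0; split => //; apply/hstripP => i.
      by have := bval_le mu i; have := bval_le mu i.+1; rewrite mu0; lia.
    rewrite mu0 eqxx mulr1 addnn -signr_odd oddD odd_double /=.
    rewrite /strip_exp big1 // => r _.
    by have := bpre_le mu r; rewrite mu0 leqn0 => /eqP ->.
  rewrite big1 => [|nu /andP[_ /eqP <-]]; last by rewrite (negPf nz) mulr0.
  have [b0|_] := eqVneq b 0%N; last by rewrite big_nil.
  by rewrite b0 addn0 in nz; rewrite big_seq1 /= (negPf nz) mulr0.
have lan : (sumn ra <= n)%N by move: ran => /=; lia.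
pose G la nu : int := (-1) ^+ (row_exp nu + row_exp mu + strip_exp la nu + strip_exp mu nu).
transitivity (\sum_la kostka_rec ra la *
  \sum_(nu | (hstrip la nu && (bsize la + a == bsize nu)%N) &&
             (hstrip mu nu && (bsize mu + b == bsize nu)%N)) G la nu).
  under eq_bigr => nu _ do rewrite kostka_rec_cons big_distrr /=.
  rewrite (exchange_big_dep xpredT) //=; apply: eq_bigr => la _.
  rewrite big_distrr /=; apply: eq_big => [nu|nu _]; first by rewrite andbC.
  by rewrite /G !exprD; ring.
(* The local rule requires [bsize la + a <= n]. This holds wherever [kostka_rec ra la] is nonzero,
   since then [bsize la = sumn ra]. *)
transitivity (\sum_la kostka_rec ra la *
  \sum_(ka | [&& hstrip ka la, hstrip ka mu, (bsize la <= bsize ka + b)%N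
              & (bsize la + a == bsize mu + b)%N])
     (-1) ^+ ((bsize mu + bsize ka) * (bsize la + bsize ka) + row_exp ka + row_exp la
              + strip_exp ka la + strip_exp ka mu)).
  apply: eq_bigr => la _.
  have [->|/kostka_rec_size sla] := eqVneq (kostka_rec ra la) 0; first by rewrite !mul0r.
  by rewrite hstrip_local_rule // sla addnC.
rewrite subcomps_cons big_flatten big_map.
(* The same sum with the intermediate shapes [ka] sorted by [i]; the induction hypothesis evaluates
   the inner sum over [la]. *)
transitivity (\sum_(0 <= i < (minn a b).+1) (-1) ^+ ((a - i) * (b - i)) *
  \sum_(ka | hstrip ka mu && (bsize ka + (a - i) == bsize mu)%N) (-1) ^+ strip_exp ka mu *
   \sum_(la | hstrip ka la && (bsize ka + (b - i) == bsize la)%N)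
     (-1) ^+ (row_exp la + row_exp ka + strip_exp ka la) * kostka_rec ra la); last first.
  rewrite /index_iota subn0; apply: eq_bigr => i _.
  rewrite big_map.
  transitivity ((-1) ^+ ((a - i) * (b - i)) *
    \sum_(ka | hstrip ka mu && (bsize ka + (a - i) == bsize mu)%N) (-1) ^+ strip_exp ka mu *
      \sum_(io <- subcomps (b - i) ra) (-1) ^+ cross_exp ra io * kostka_rec (subw ra io) ka).
    by congr (_ * _); apply: eq_bigr => ka _; rewrite IH.
  rewrite big_distrr /=; under eq_bigr => ka _ do rewrite mulrA big_distrr /=.
  rewrite exchange_big /= [LHS]big_seq [RHS]big_seq.
  apply: eq_bigr => io; rewrite mem_subcomps => /and3P[_ _ /eqP sio].
  rewrite big_distrr /=; apply: eq_bigr => ka _.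
  by rewrite sio exprD; ring.
rewrite big_mkord.
under [RHS]eq_bigr => i _ do (rewrite big_distrr /=; under eq_bigr => ka _ do
  (rewrite mulrA big_distrr /=)).
under [LHS]eq_bigr => la _ do rewrite big_distrr /=.
rewrite (exchange_big_dep xpredT) //= [RHS](exchange_big_dep xpredT) //=.
apply: eq_bigr => ka _.
rewrite [RHS](exchange_big_dep xpredT) //= [LHS]big_mkcond /=.
apply: eq_bigr => la _; case: ifP => [/and4P[H1 H2 H3 /eqP H4]|H]; last first.
  rewrite big_pred0 // => i; apply: contraFF H.
  case/andP=> /andP[-> /eqP E1] /andP[-> /eqP E2] /=.
  by have := ltn_ord i; have := geq_minl a b; have := geq_minr a b; lia.
have S1 := hstrip_size H1; have S2 := hstrip_size H2.
(* For given [ka] and [la] the only contributing [i] has [b - i = bsize la - bsize ka]. *)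
have im : (b - (bsize la - bsize ka) < (minn a b).+1)%N by lia.
rewrite (big_pred1 (Ordinal im)) => [|i /=].
  rewrite /= (_ : (a - _)%N = (bsize mu - bsize ka)%N); last by lia.
  rewrite (_ : (b - _)%N = (bsize la - bsize ka)%N); last by lia.
  rewrite !exprD -[in RHS]signr_odd oddM !oddB // -oddD -oddD -oddM signr_odd.
  by ring.
rewrite H1 H2 -val_eqE /=.
have := ltn_ord i; have := geq_minl a b; have := geq_minr a b; lia.
Qed.

(** The right-hand side of (1): signs of canonical tableaux would cancel in the product, and boxes
    that are not weakly decreasing contribute 0. *)
Definition kostka_pairing (ra rb : seq nat) : int :=
  \sum_nu (-1) ^+ row_exp nu * kostka_rec ra nu * kostka_rec rb nu.

(** For the pairing weighted by eps, D_b is the adjoint of U_b; moved to the other factor it is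
    evaluated by [kostka_rec_skew]. *)
Lemma kostka_pairing_cons ra b rb : (sumn ra <= n)%N ->
  kostka_pairing ra (b :: rb) =
  \sum_(io <- subcomps b ra) (-1) ^+ cross_exp ra io * kostka_pairing (subw ra io) rb.
Proof.
move=> ran; rewrite /kostka_pairing /=.
under eq_bigr => nu _ do rewrite big_distrr /=.
rewrite (exchange_big_dep xpredT) //=.
under [RHS]eq_bigr => io _ do rewrite big_distrr /=.
rewrite [RHS]exchange_big; apply: eq_bigr => mu _.
transitivity ((-1) ^+ row_exp mu * kostka_rec rb mu *
  \sum_(io <- subcomps b ra) (-1) ^+ cross_exp ra io * kostka_rec (subw ra io) mu); last first.
  by rewrite big_distrr; apply: eq_bigr => io _ /=; ring.
rewrite -kostka_rec_skew // big_distrr /=; apply: eq_big => [//|nu _].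
rewrite !exprD.
have : (-1) ^+ row_exp mu * (-1) ^+ row_exp mu = 1 :> int by rewrite -expr2 sqrr_sign.
move: ((-1) ^+ row_exp mu) => e ee.
rewrite [RHS](_ : _ = e * e * ((-1) ^+ row_exp nu * (-1) ^+ strip_exp mu nu * kostka_rec ra nu * kostka_rec rb mu)); last by ring.
by rewrite ee; ring.
Qed.

Definition box0 : box n := mkbox n (fun=> 0%N).

Lemma bval_box0 i : bval box0 i = 0%N.
Proof. by case: (leqP i n) => ni; [rewrite bval_mkbox | rewrite bval_out]. Qed.

Lemma bsize_box0 : bsize box0 = 0%N.
Proof. by rewrite /bsize big1 // => i _; rewrite bval_box0. Qed.

Lemma kostka_rec_box0 ra : kostka_rec ra box0 = (sumn ra == 0)%:R.
Proof.
elim: ra => [|a ra IH]; first by rewrite /= bsize_box0.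
rewrite kostka_rec_cons bsize_box0 [sumn _]/=.
case: a => [|a]; last by rewrite big_pred0 // => la; rewrite addnS andbF.
rewrite (big_pred1 box0) => [|la]; last first.
  rewrite addn0; apply/andP/eqP => [[_ /eqP l0]|->]; first exact: bsize0_inj l0 bsize_box0.
  by rewrite bsize_box0; split=> //; apply/hstripP => i; rewrite !bval_box0.
rewrite IH /strip_exp big1 ?mul1r // => r _.
by rewrite !bval_box0 muln0.
Qed.

Lemma kostka_pairing_nil ra : kostka_pairing ra [::] = (sumn ra == 0)%:R.
Proof.
rewrite /kostka_pairing (bigD1 box0) //= big1 ?addr0 => [|nu /eqP nu0]; last first.
  case: eqP => [z|]; last by rewrite mulr0.
  by case: nu0; apply: bsize0_inj bsize_box0.
rewrite bsize_box0 kostka_rec_box0 mulr1 /row_exp big1 ?mul1r // => i _.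
by rewrite bval_box0 muln0.
Qed.

End Kostka.

(** * Signs of tableaux *)

Section Inversions.
Local Open Scope nat_scope.

Fixpoint seq_inv (w : seq nat) : nat :=
  if w is x :: w' then count (fun y => y < x) w' + seq_inv w' else 0.

Definition cross_inv (u v : seq nat) : nat :=
  sumn [seq count (fun y => y < x) v | x <- u].

Lemma word_invE w : word_inv w = seq_inv w.
Proof.
rewrite /word_inv -sum1_card.
under eq_bigl => p do rewrite inE.
rewrite big_mkcond /=.
rewrite -(pair_bigA _ (fun i j : 'I_(size w) =>
  if (i < j) && (nth 0 w j < nth 0 w i) then 1 else 0)).
elim: w => [|x w IH]; first by rewrite big_ord0.
rewrite /= big_ord_recl -IH; congr (_ + _).
  rewrite big_ord_recl /= add0n -sum1_count (big_nth 0) big_mkord [RHS]big_mkcond.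
  by apply: eq_bigr.
by apply: eq_bigr => i _; rewrite big_ord_recl /=.
Qed.

Lemma cross_inv_catl u u' v : cross_inv (u ++ u') v = cross_inv u v + cross_inv u' v.
Proof. by rewrite /cross_inv map_cat sumn_cat. Qed.

Lemma cross_inv_catr u v v' : cross_inv u (v ++ v') = cross_inv u v + cross_inv u v'.
Proof.
elim: u => //= x u IH; rewrite /cross_inv /= count_cat -!/(cross_inv _ _).
by rewrite IH; lia.
Qed.

Lemma perm_cross_inv u u' v v' : perm_eq u u' -> perm_eq v v' ->
  cross_inv u v = cross_inv u' v'.
Proof.
move=> pu pv; rewrite /cross_inv (perm_sumn (perm_map _ pu)).
by congr sumn; apply: eq_map => x; move/seq.permP: pv => ->.
Qed.

Lemma seq_inv_cat u v : seq_inv (u ++ v) = seq_inv u + seq_inv v + cross_inv u v.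
Proof.
elim: u => [|x u IH] /=; first by rewrite /cross_inv /= addn0.
by rewrite IH /cross_inv /= count_cat; lia.
Qed.

Lemma cross_inv0 u v : (forall x y, x \in u -> y \in v -> x <= y) -> cross_inv u v = 0.
Proof.
elim: u => //= x u IH H; rewrite /cross_inv /= -/(cross_inv _ _) IH ?addn0; last first.
  by move=> z y zu; apply: H; rewrite inE zu orbT.
apply/eqP; rewrite eqn0Ngt -has_count; apply/hasPn => y yv.
by rewrite -leqNgt H ?mem_head.
Qed.

Lemma cross_inv_full u v : (forall x y, x \in u -> y \in v -> y < x) ->
  cross_inv u v = size u * size v.
Proof.
elim: u => //= x u IH H; rewrite /cross_inv /= -/(cross_inv _ _) IH; last first.
  by move=> z y zu; apply: H; rewrite inE zu orbT.
rewrite mulSn; congr (_ + _); apply/eqP; rewrite -all_count.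
by apply/allP => y yv; apply: H; rewrite ?mem_head.
Qed.

Lemma seq_inv_sorted w : sorted leq w -> seq_inv w = 0.
Proof.
elim: w => //= x w IH xw; rewrite IH ?(path_sorted xw) // addn0.
apply/eqP; rewrite eqn0Ngt -has_count; apply/hasPn => y yw.
by rewrite -leqNgt; move/(order_path_min leq_trans)/allP: xw; apply.
Qed.

End Inversions.

(** * Removing the largest letter from a semistandard tableau *)

Section Tableaux.
Local Open Scope nat_scope.

Definition col_lt (r r' : seq nat) : bool :=
  (size r' <= size r) && all (fun j => nth 0 r j < nth 0 r' j) (iota 0 (size r')).

Lemma column_short T j : all (fun r => size r <= j) T -> column T j = [::].
Proof.
rewrite /column => H; rewrite (_ : [seq r <- T | _] = [::]) //.
by elim: T H => //= r T IH /andP[rj /IH ->]; rewrite ltnNge rj.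
Qed.

Lemma sorted_geq_head r (T : seq (seq nat)) : sorted geq (shape (r :: T)) ->
  all (fun r' => size r' <= size r) T.
Proof.
have tr : transitive geq by move=> x y z xy yz; apply: leq_trans yz xy.
by move/(order_path_min tr); rewrite all_map.
Qed.

(** Columns of a partition shape have no gaps, so strictness is a condition on adjacent rows.
    Columns beyond the first row are empty, which allows [j] to be unbounded in the induction. *)
Lemma sorted_columns T : sorted geq (shape T) ->
  all (fun j => sorted ltn (column T j)) (iota 0 (head 0 (shape T))) = sorted col_lt T.
Proof.
move=> sT; have sub j : head 0 (shape T) <= j -> column T j = [::].
  case: T sT => //= r T /sorted_geq_head H rj; apply: column_short => /=.
  by rewrite rj; apply: sub_all H => r' /leq_trans; apply.
suff E : (forall j, sorted ltn (column T j)) <-> sorted col_lt T.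
  apply/allP/idP => [H|/E H j _]; last exact: H.
  apply/E => j; case: (ltnP j (head 0 (shape T))) => jT; last by rewrite sub.
  by apply: H; rewrite mem_iota.
elim: T sT {sub} => [|r [|r' T] IH] sT //.
  by split=> // _ j; rewrite /column /=; case: ifP.
have {}IH := IH (path_sorted sT).
have rr' : size r' <= size r by case/andP: sT.
have H' := sorted_geq_head (path_sorted sT : sorted geq (shape (r' :: T))).
have cE j : j < size r' ->
   column (r :: r' :: T) j = [:: nth 0 r j, nth 0 r' j & column T j]
   /\ column (r' :: T) j = nth 0 r' j :: column T j.
  by move=> jr'; rewrite /column /= jr' (leq_trans jr' rr').
have cN j : size r' <= j -> column (r' :: T) j = [::].
  move=> jr'; apply: column_short => /=.
  by rewrite jr'; apply: sub_all H' => x /leq_trans; apply.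
split=> [H|/andP[/andP[_ /allP H1] /IH H2] j].
  apply/andP; split; last first.
    by apply/IH => j; have := H j; rewrite /column /=; case: ifP => // _ /path_sorted.
  rewrite /col_lt rr' /=; apply/allP => j; rewrite mem_iota /= => jr'.
  by have := H j; have [-> _] := cE j jr'; case/andP.
case: (ltnP j (size r')) => jr'.
  have [-> E] := cE j jr'; have := H2 j; rewrite E /= => ->.
  by rewrite H1 ?mem_iota.
have := cN j jr'; rewrite /column /= => E.
by case: ifP => _ /=; rewrite E.
Qed.

Lemma semistandardE T : sorted geq (shape T) ->
  semistandard T = [&& 0 \notin flatten T, all (sorted leq) T & sorted col_lt T].
Proof. by move=> sT; rewrite /semistandard sorted_columns. Qed.

Lemma content_word_rcons al a :
  content_word (rcons al a) = content_word al ++ nseq a (size al).+1.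
Proof.
rewrite /content_word size_rcons -[in iota _ _](addn1 (size al)) iotaD add0n map_cat.
rewrite flatten_cat /= cats0 nth_rcons ltnn eqxx; congr (flatten _ ++ _).
by apply/eq_in_map => i; rewrite mem_iota /= nth_rcons => ->.
Qed.

Lemma size_content_word al : size (content_word al) = sumn al.
Proof.
elim/last_ind: al => // al a IH.
by rewrite content_word_rcons size_cat size_nseq IH sumn_rcons.
Qed.

Lemma mem_content_word al x : x \in content_word al -> 0 < x <= size al.
Proof.
elim/last_ind: al => // al a IH; rewrite content_word_rcons mem_cat size_rcons.
by case/orP=> [/IH|/nseqP[-> _]]; lia.
Qed.

Lemma count_content_word al i : count_mem i.+1 (content_word al) = nth 0 al i.
Proof.
elim/last_ind: al => [|al a IH]; first by rewrite nth_nil.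
rewrite content_word_rcons count_cat IH count_nseq nth_rcons /= eqSS.
case: (ltngtP i (size al)) => [ia|ia|->]; rewrite ?eqxx ?mul0n ?addn0 ?mul1n //.
  by rewrite nth_default // ltnW.
by rewrite nth_default.
Qed.

Lemma max_content_word al : 0 \notin al -> \max_(x <- content_word al) x = size al.
Proof.
elim/last_ind: al => [|al a IH] al0; first by rewrite big_nil.
move: al0; rewrite mem_rcons inE negb_or => /andP[a0 /IH {}IH].
rewrite content_word_rcons big_cat /= IH size_rcons.
rewrite big_nseq; case: a a0 => // a _.
elim: a => [|a IHa]; first by rewrite /= maxn0; lia.
by move: IHa; rewrite /=; lia.
Qed.

(** [content] ends at the largest letter of [T]. As [al] has no zero part, the largest letter of
    [content_word al] is [size al], and the two lists have the same length. *)
Lemma content_permE T al : 0 \notin al ->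
  (0 \notin flatten T) && (content T == al) = perm_eq (flatten T) (content_word al).
Proof.
move=> al0; apply/andP/idP => [[T0 /eqP <-]|p].
  rewrite /content_word size_map size_iota.
  rewrite (_ : [seq nseq (nth 0 (content T) i) i.+1
            | i <- iota 0 (\max_(x <- flatten T) x)] =
          [seq nseq (count_mem i.+1 (flatten T)) i.+1
          | i <- iota 0 (\max_(x <- flatten T) x)]).
    by apply: perm_content_word => //; apply/allP=> x xT /=; rewrite (leq_bigmax_seq (F := id)).
  apply/eq_in_map => i; rewrite mem_iota /= add0n => iM.
  by rewrite /content (nth_map 0) ?size_iota // nth_iota.
split; first by rewrite (perm_mem p); apply/negP => /mem_content_word.
rewrite /content (perm_big _ p) max_content_word //=; apply/eqP.
apply: (@eq_from_nth _ 0); rewrite size_map size_iota // => i iM.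
rewrite (nth_map 0) ?size_iota // nth_iota // -count_content_word.
by move/seq.permP: p => ->.
Qed.

Lemma mem_tableauxE la al T : sorted geq la -> 0 \notin al ->
  (T \in tableaux la al) = [&& shape T == la, all (sorted leq) T, sorted col_lt T
                            & perm_eq (flatten T) (content_word al)].
Proof.
move=> sla al0; rewrite mem_tableaux -content_permE //.
case: eqP => [E|_]; last by rewrite andbF.
rewrite semistandardE ?E //.
by case: (0 \notin _); case: all; case: sorted; case: (content T == al).
Qed.

Definition add_letters (k : nat) (T : seq (seq nat)) (cs : seq nat) : seq (seq nat) :=
  [seq p.1 ++ nseq p.2 k | p <- zip T cs].

Definition drop_letter (k : nat) (T : seq (seq nat)) : seq (seq nat) :=
  [seq [seq x <- r | x < k] | r <- T].

Lemma sorted_split_max k r : sorted leq r -> all (geq k) r ->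
  r = [seq x <- r | x < k] ++ nseq (size r - size [seq x <- r | x < k]) k.
Proof.
elim: r => //= x r IH xr /andP[xk rk].
have {IH} := IH (path_sorted xr) rk.
case: ltnP => kx E /=; first by rewrite subSS -E.
have {xk kx} xk : x = k by apply/eqP; rewrite eqn_leq xk.
have F : [seq y <- r | y < k] = [::].
  apply/eqP; rewrite -[_ == _]negbK -has_filter; apply/hasPn => y yr.
  by move/(order_path_min leq_trans)/allP/(_ y yr): xr; rewrite xk -leqNgt.
by move: E; rewrite F subn0 xk /= => {1}->.
Qed.

(** The new letters exceed all old ones and equal each other, so none may stand below another: the
    extended lower row has to fit under the old cells of the upper row. This is the horizontal strip
    condition. *)
Lemma col_lt_add k r r' c c' : all (gtn k) r -> all (gtn k) r' ->
  col_lt (r ++ nseq c k) (r' ++ nseq c' k) = col_lt r r' && (size r' + c' <= size r).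
Proof.
move=> rk r'k; rewrite /col_lt !size_cat !size_nseq.
apply/andP/andP => [[H1 /allP H2]|[/andP[H1 /allP H2] H3]].
  have H3 : size r' + c' <= size r.
    rewrite leqNgt; apply/negP => H.
    have /H2 : size r \in iota 0 (size r' + c') by rewrite mem_iota.
    rewrite nth_cat ltnn subnn nth_nseq (_ : 0 < c); last by lia.
    rewrite nth_cat; case: (ltnP (size r) (size r')) => sr.
      by move/all_nthP: r'k => /(_ 0 _ sr) /=; lia.
    by rewrite nth_nseq; case: ifP; lia.
  split=> //; rewrite (leq_trans (leq_addr _ _) H3); apply/allP => j.
  rewrite mem_iota /= => jr'; have /H2 : j \in iota 0 (size r' + c') by rewrite mem_iota; lia.
  by rewrite !nth_cat jr' (_ : j < size r) //; lia.
split; first by lia.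
apply/allP => j; rewrite mem_iota /= add0n => jr'.
rewrite !nth_cat (_ : j < size r); last by lia.
case: (ltnP j (size r')) => jr''; first by apply: H2; rewrite mem_iota.
rewrite nth_nseq (_ : j - size r' < c'); last by lia.
by move/all_nthP: rk => /(_ 0 j) /=; apply; lia.
Qed.

Lemma sorted_col_lt_add k T cs : size cs = size T -> all (all (gtn k)) T ->
  sorted col_lt (add_letters k T cs) =
  sorted col_lt T && sorted (fun p q : seq nat * nat => size q.1 + q.2 <= size p.1) (zip T cs).
Proof.
case: T cs => [|r T] [|c cs] //= [sc] /andP[rk Tk].
elim: T cs r c rk Tk sc => [|r' T IH] [|c' cs] r c rk //= /andP[r'k Tk] [sc].
rewrite -/(add_letters _ _ _) IH // col_lt_add //.
by case: col_lt => //=; case: (_ <= _); rewrite ?andbF.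
Qed.

Lemma sorted_rows_add k T cs : size cs = size T -> all (all (gtn k)) T ->
  all (sorted leq) (add_letters k T cs) = all (sorted leq) T.
Proof.
elim: T cs => [|r T IH] [|c cs] //= [sc] /andP[rk Tk].
rewrite -/(add_letters _ _ _) IH //; congr (_ && _).
elim: r rk => [|x r IHr] /=; first by case: c => //= c _; elim: c => //= c ->; rewrite leqnn.
case/andP=> xk rk; have {}IHr := IHr rk.
case: r rk IHr => [|y r] /= rk; last by move=> ->.
case: c => //= c ->; rewrite andbT; exact: ltnW.
Qed.

Lemma flatten_add k T cs : size cs = size T ->
  perm_eq (flatten (add_letters k T cs)) (flatten T ++ nseq (sumn cs) k).
Proof.
elim: T cs => [|r T IH] [|c cs] //= [sc].
rewrite -/(add_letters _ _ _) nseqD -!catA perm_cat2l.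
rewrite perm_sym perm_catCA perm_cat2l perm_sym.
exact: IH.
Qed.

Fixpoint strip_cross (T : seq (seq nat)) (cs : seq nat) : nat :=
  match T, cs with
  | r :: T', _ :: cs' => sumn cs' * size r + strip_cross T' cs'
  | _, _ => 0
  end.

(** Rows are read from the bottom, so a new letter precedes, and exceeds, exactly the old letters of
    the higher rows; it creates no other inversion. *)
Lemma row_word_add k T cs : size cs = size T -> all (all (gtn k)) T ->
  seq_inv (row_word (add_letters k T cs)) = seq_inv (row_word T) + strip_cross T cs.
Proof.
rewrite /row_word; elim: T cs => [|r T IH] [|c cs] //= [sc] /andP[rk Tk].
rewrite -/(add_letters _ _ _) !rev_cons !flatten_rcons !seq_inv_cat IH //.
rewrite (@seq_inv_sorted (nseq c k)); last first.
  by elim: c => //= -[|c] //= ->; rewrite leqnn.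
rewrite (@cross_inv0 r (nseq c k)); last first.
  by move=> x y /(allP rk) /= xk /nseqP[-> _]; apply: ltnW.
have p : perm_eq (flatten (rev (add_letters k T cs))) (flatten (rev T) ++ nseq (sumn cs) k).
  have pr (X : seq (seq nat)) : perm_eq (flatten (rev X)) (flatten X).
    by apply: perm_flatten; rewrite perm_rev.
  apply: perm_trans (pr _) _; apply: perm_trans (flatten_add k sc) _.
  by rewrite perm_cat2r perm_sym pr.
rewrite (perm_cross_inv p (perm_refl _)) cross_inv_catr !cross_inv_catl.
rewrite (@cross_inv_full (nseq _ k) r); last first.
  by move=> x y /nseqP[-> _] /(allP rk).
rewrite [cross_inv _ (nseq c k)]cross_inv0; last first.
  move=> x y /flattenP[u]; rewrite mem_rev => uT xu /nseqP[-> _].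
  by apply: ltnW; apply: (allP (allP Tk u uT)).
rewrite [cross_inv _ (nseq c k)]cross_inv0; last by move=> x y /nseqP[-> _] /nseqP[-> _].
rewrite size_nseq /=; lia.
Qed.

(** The same count grouped by the row of the new letter instead of that of the old one, as in
    [strip_exp]. *)
Lemma strip_crossE T cs : size cs = size T ->
  strip_cross T cs = \sum_(i < size T) (\sum_(s < i) nth 0 (shape T) s) * nth 0 cs i.
Proof.
elim: T cs => [|r T IH] [|c cs] //=; first by rewrite big_ord0.
case=> sc; rewrite big_ord_recl big_ord0 mul0n add0n IH //.
under [RHS]eq_bigr => i _ do rewrite /= big_ord_recl /= mulnDl.
rewrite big_split /= -big_distrr /= mulnC; congr (_ * _ + _).
by rewrite sumnE (big_nth 0) big_mkord sc.
Qed.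

Variable n : nat.

Definition box_seq (p : box n) : seq nat := map val p.

Lemma size_box_seq p : size (box_seq p) = n.+1.
Proof. by rewrite size_map size_tuple. Qed.

Lemma nth_box_seq p i : nth 0 (box_seq p) i = bval p i. Proof. by []. Qed.

Lemma sumn_box_seq p : sumn (box_seq p) = bsize p.
Proof. by rewrite sumnE (big_nth 0) big_mkord size_box_seq. Qed.

Lemma box_seq_inj : injective box_seq.
Proof. by move=> p q pq; apply: eq_box => i _; rewrite -!nth_box_seq pq. Qed.

Lemma mkbox_box_seq (s : seq nat) : size s = n.+1 -> (forall i, nth 0 s i <= n) ->
  box_seq (mkbox n (nth 0 s)) = s.
Proof.
move=> ss sn; apply: (@eq_from_nth _ 0); rewrite size_box_seq // => i iN.
by rewrite nth_box_seq bval_mkbox.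
Qed.

Lemma sorted_box_seq p : reflect (forall i, bval p i.+1 <= bval p i) (sorted geq (box_seq p)).
Proof.
apply: (iffP (sortedP 0)) => H i; last by move=> _; rewrite !nth_box_seq; apply: H.
case: (ltnP i.+1 n.+1) => iN; last by rewrite bval_out.
by apply: H; rewrite size_box_seq.
Qed.

Definition strip_of (nu : box n) (T : seq (seq nat)) : seq nat :=
  [seq p.1 - p.2 | p <- zip (box_seq nu) (shape T)].

Lemma size_strip_of nu la T : shape T = box_seq la -> size (strip_of nu T) = size T.
Proof.
by move=> sT; rewrite size_map size_zip -(size_map size) -/(shape T) sT !size_box_seq minnn.
Qed.

Lemma nth_strip_of nu la T i : shape T = box_seq la -> nth 0 (strip_of nu T) i = bval nu i - bval la i.
Proof.
move=> sT; case: (ltnP i n.+1) => iN; last first.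
  rewrite bval_out // nth_default // (size_strip_of _ sT).
  by rewrite -(size_map size) -/(shape T) sT size_box_seq.
rewrite (nth_map (0,0)) ?size_zip ?sT ?size_box_seq ?minnn //.
by rewrite nth_zip ?size_box_seq.
Qed.

(** The largest letter fills a horizontal strip, and [drop_letter] undoes [add_letters]. Padding
    shapes to [n.+1] rows keeps the number of rows constant. *)
Lemma tableaux_rcons (nu : box n) al a : sorted geq (box_seq nu) -> 0 \notin rcons al a ->
  perm_eq (tableaux (box_seq nu) (rcons al a))
    [seq add_letters (size al).+1 T (strip_of nu T)
    | la <- enum [pred la | hstrip la nu && (bsize la + a == bsize nu)],
      T <- tableaux (box_seq la) al].
Proof.
move=> snu al0'; have al0 : 0 \notin al.
  by move: al0'; rewrite mem_rcons inE negb_or => /andP[].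
set k := (size al).+1.
have small la T : T \in tableaux (box_seq la) al -> hstrip la nu -> all (all (gtn k)) T.
  move=> + /hstrip_decrl H; rewrite mem_tableauxE //; last exact/sorted_box_seq.
  case/and4P=> _ _ _ p; apply/allP => r rT; apply/allP => x xr.
  have : x \in flatten T by apply/flattenP; exists r.
  by rewrite (perm_mem p) => /mem_content_word; rewrite /k /=; lia.
have shp la T : T \in tableaux (box_seq la) al -> shape T = box_seq la.
  by rewrite mem_tableaux => /and3P[_ /eqP].
have restrict T cs : size cs = size T -> all (all (gtn k)) T ->
    drop_letter k (add_letters k T cs) = T.
  elim: T cs => [|r T IH] [|c cs] //= [sc] /andP[rk Tk].
  rewrite -/(drop_letter _ _) IH // filter_cat; congr cons.
  have -> : [seq x <- nseq c k | x < k] = [::].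
    by elim: c => //= c ->; rewrite ltnn.
  by rewrite cats0; apply/all_filterP.
apply: uniq_perm; first exact: uniq_tableaux.
  apply: allpairs_uniq_dep => [|la _|]; first exact: enum_uniq.
    exact: uniq_tableaux.
  move=> _ _ /allpairsPdep[la [T [laP TP ->]]] /allpairsPdep[la' [T' [la'P T'P ->]]] /=.
  move: laP la'P; rewrite !mem_enum !inE => /andP[h _] /andP[h' _].
  move=> /(congr1 (drop_letter k)).
  rewrite !restrict ?(small _ _ TP) ?(small _ _ T'P) ?(size_strip_of _ (shp _ _ TP))
    ?(size_strip_of _ (shp _ _ T'P)) // => TT'.
  have E : la = la' by apply: box_seq_inj; rewrite -(shp _ _ TP) TT' (shp _ _ T'P).
  by case: _ / E in T'P h' TT' *; rewrite TT'.
move=> T; apply/idP/allpairsPdep => [|[la [T' [laP T'P ->]]]]; last first.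
  move: laP; rewrite mem_enum inE => /andP[h /eqP sz].
  have Tk := small _ _ T'P h; have sT := shp _ _ T'P.
  have sc := size_strip_of nu sT.
  rewrite mem_tableauxE // sorted_rows_add // sorted_col_lt_add //.
  move: T'P; rewrite mem_tableauxE //; last by apply/sorted_box_seq => i; exact: hstrip_decrl h.
  case/and4P=> _ -> -> p; move/hstripP in h.
  have szT : size T' = n.+1 by rewrite -(size_map size) -/(shape T') sT size_box_seq.
  have shE : shape (add_letters k T' (strip_of nu T')) = box_seq nu.
    apply: (@eq_from_nth _ 0); rewrite size_map size_map size_zip sc minnn szT ?size_box_seq // => i iN.
    rewrite /shape -map_comp (nth_map ([::], 0)) ?size_zip ?sc ?minnn ?szT //=.
    rewrite nth_zip // size_cat size_nseq (nth_strip_of _ _ sT) /=.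
    have -> : size (nth [::] T' i) = bval la i by rewrite -(nth_map _ 0) ?szT // -/(shape T') sT.
    by rewrite nth_box_seq; have := h i; lia.
  rewrite shE eqxx /=; apply/andP; split.
    apply/(sortedP ([::], 0)) => i; rewrite size_zip sc minnn szT => iN.
    rewrite !nth_zip //= (nth_strip_of _ _ sT).
    have E j : j < n.+1 -> size (nth [::] T' j) = bval la j.
      by move=> jN; rewrite -(nth_map _ 0) ?szT // -/(shape T') sT.
    by rewrite !E ?(ltnW iN) //; have := h i; have := h i.+1; lia.
  rewrite content_word_rcons (perm_trans (flatten_add k sc)) //.
  rewrite (_ : sumn _ = a) ?perm_cat2r //.
  have : sumn (strip_of nu T') + bsize la = bsize nu.
    rewrite sumnE (big_nth 0) big_mkord sc szT /bsize -big_split.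
    by apply: eq_bigr => i _; rewrite /= (nth_strip_of _ _ sT); have := h i; lia.
  lia.
(* Conversely, [la] is the shape left after deleting the letters [k] from [T]. *)
rewrite mem_tableauxE // => /and4P[/eqP shT rT cT p].
have Tle : all (all (geq k)) T.
  apply/allP => r rT'; apply/allP => x xr.
  have : x \in flatten T by apply/flattenP; exists r.
  by rewrite (perm_mem p) => /mem_content_word; rewrite size_rcons /k /=; lia.
have szT : size T = n.+1 by rewrite -(size_map size) -/(shape T) shT size_box_seq.
pose T' := drop_letter k T.
have T'k : all (all (gtn k)) T'.
  by apply/allP => _ /mapP[r _ ->]; apply: filter_all.
have szT' : size T' = n.+1 by rewrite size_map.
have row_size i : size (nth [::] T i) = bval nu i.
  by rewrite -nth_box_seq -shT /shape; case: (ltnP i n.+1) => iN;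
     [rewrite (nth_map [::]) ?szT | rewrite !nth_default // ?size_map szT].
pose la := mkbox n (nth 0 (shape T')).
have shT' : shape T' = box_seq la.
  rewrite mkbox_box_seq ?size_map // => i.
  case: (ltnP i n.+1) => iN; last by rewrite nth_default // size_map szT'.
  rewrite (nth_map [::]) ?szT' // (nth_map [::]) ?szT //.
  by rewrite size_filter (leq_trans (count_size _ _)) ?row_size ?bval_ub.
have row_size' i : size (nth [::] T' i) = bval la i.
  by rewrite -nth_box_seq -shT' /shape; case: (ltnP i n.+1) => iN;
     [rewrite (nth_map [::]) ?szT' | rewrite !nth_default // ?size_map szT].
have nth_row i : i < n.+1 -> nth [::] T i =
    nth [::] T' i ++ nseq (bval nu i - bval la i) k.
  move=> iN; rewrite -row_size' -row_size (nth_map [::]) ?szT //.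
  by apply: sorted_split_max; [apply: (allP rT) | apply: (allP Tle)]; rewrite mem_nth ?szT.
have sc := size_strip_of nu shT'.
have TE : T = add_letters k T' (strip_of nu T').
  apply: (@eq_from_nth _ [::]); first by rewrite size_map size_zip sc minnn szT szT'.
  move=> i; rewrite szT => iN.
  rewrite (nth_map ([::], 0)) ?size_zip ?sc ?minnn ?szT' // nth_zip //=.
  by rewrite (nth_strip_of _ _ shT') nth_row.
move: rT cT; rewrite {1 2}TE sorted_rows_add // sorted_col_lt_add // => rT' /andP[cT' hT'].
have le_la i : bval la i <= bval nu i.
  rewrite -row_size' -row_size; case: (ltnP i n.+1) => iN.
    by rewrite (nth_map [::]) ?szT // size_filter count_size.
  by rewrite !nth_default // ?szT ?szT'.
have h : hstrip la nu.
  apply/hstripP => i; split; first exact: le_la.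
  case: (ltnP i.+1 n.+1) => iN; last by rewrite (bval_out nu).
  move/(sortedP ([::], 0)): hT' => /(_ i); rewrite size_zip sc minnn szT' => /(_ iN).
  rewrite !nth_zip //= !row_size' (nth_strip_of _ _ shT').
  by have := le_la i.+1; lia.
have p' : perm_eq (flatten T') (content_word al).
  have := perm_filter (gtn k) (perm_trans (_ : perm_eq _ (flatten T)) p).
  move/(_ (flatten T' ++ nseq (sumn (strip_of nu T')) k)).
  rewrite perm_sym {1}TE flatten_add // => /(_ isT).
  rewrite content_word_rcons !filter_cat.
  have F c : [seq x <- nseq c k | gtn k x] = [::].
    by elim: c => //= c ->; rewrite ltnn.
  rewrite !F !cats0 (all_filterP _) => [|]; last first.
    apply/allP => x /flattenP[r rT xr]; exact: (allP (allP T'k r rT)).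
  rewrite (all_filterP _) //.
  by apply/allP => x /mem_content_word; rewrite /k /=; lia.
exists la, T'; split => //.
  rewrite mem_enum inE h /=.
  have := perm_size p; have := perm_size p'.
  rewrite !size_content_word !size_flatten sumn_rcons shT shT' !sumn_box_seq.
  lia.
rewrite mem_tableauxE ?shT' ?eqxx ?rT' ?cT' //; apply/sorted_box_seq => i; exact: hstrip_decrl h.
Qed.

Local Open Scope ring_scope.

(** Induction on the largest letter: by [row_word_add] its removal changes the sign by
    [strip_cross], which has the parity of [strip_exp]. *)
Lemma sum_tableaux_sign (nu : box n) al : sorted geq (box_seq nu) -> 0%N \notin al ->
  \sum_(T <- tableaux (box_seq nu) al) tableau_sign T = kostka_rec (rev al) nu.
Proof.
elim/last_ind: al nu => [|al a IH] nu snu al0.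
  rewrite [RHS]/=; case: eqP => nu0; last first.
    rewrite big_seq big1 // => T; rewrite mem_tableauxE // => /and4P[/eqP sT _ _ /perm_size].
    by rewrite size_content_word size_flatten sT sumn_box_seq => /nu0.
  have nuE : box_seq nu = nseq n.+1 0%N.
    apply: (@eq_from_nth _ 0%N); rewrite ?size_nseq size_box_seq // => i iN.
    by rewrite nth_nseq iN nth_box_seq; have := bval_le nu i; rewrite nu0; lia.
  have fE j : flatten (nseq j ([::] : seq nat)) = [::] by elim: j.
  rewrite (perm_big [:: nseq n.+1 [::]]) ?big_seq1.
    by rewrite /tableau_sign word_invE /row_word rev_nseq fE.
  apply: uniq_perm => // [|T]; first exact: uniq_tableaux.
  rewrite mem_tableauxE // inE; apply/and4P/eqP => [[/eqP sT _ _ _]|->].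
    apply: (@eq_from_nth _ [::]); rewrite -(size_map size) -/(shape T) sT size_box_seq ?size_nseq //.
    move=> i iN; rewrite nth_nseq iN; apply/nilP; rewrite /nilp.
    have iT : (i < size T)%N by rewrite -(size_map size) -/(shape T) sT size_box_seq.
    by rewrite -(nth_map _ 0%N) // -/(shape T) sT nuE nth_nseq iN.
  split; first by rewrite nuE /shape map_nseq.
  - by apply/allP => x /nseqP[->].
  - by apply/(sortedP [::]) => i iN; rewrite !nth_nseq; do 2 case: ifP => //.
  - by rewrite fE.
rewrite (perm_big _ (tableaux_rcons snu al0)) big_allpairs_dep /=.
rewrite rev_rcons kostka_rec_cons big_enum /=; apply: eq_bigr => la /andP[h sz].
have al0' : 0%N \notin al.
  by move: al0; rewrite mem_rcons inE negb_or => /andP[].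
rewrite -IH //; last by apply/sorted_box_seq => i; exact: hstrip_decrl h.
rewrite big_distrr /= big_seq [RHS]big_seq; apply: eq_bigr => T.
rewrite mem_tableauxE //; last by apply/sorted_box_seq => i; exact: hstrip_decrl h.
case/and4P=> /eqP sT _ _ p; have sc := size_strip_of nu sT.
rewrite /tableau_sign !word_invE row_word_add //; last first.
  apply/allP => r rT; apply/allP => x xr.
  have : x \in flatten T by apply/flattenP; exists r.
  by rewrite (perm_mem p) => /mem_content_word /=; lia.
rewrite exprD mulrC -signr_odd -[in RHS]signr_odd; congr (_ ^+ (nat_of_bool _) * _).
rewrite strip_crossE // /strip_exp; move/hstripP in h.
have -> : size T = n.+1 by rewrite -(size_map size) -/(shape T) sT size_box_seq.
rewrite sT; elim/big_ind2: _ => // [a1 b1 a2 b2|i _]; first by rewrite !oddD => -> ->.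
rewrite (nth_strip_of _ _ sT) oddM [in RHS]oddM oddB ?oddD //.
by case: (h i).
Qed.

End Tableaux.

(** * Partitions as boxes, triangularity *)

Section PartitionBoxes.
Local Open Scope nat_scope.
Variable n : nat.

Definition part_box (la : intpart n) : box n := mkbox n (nth 0 la).

Lemma part_sorted (la : intpart n) : sorted geq la.
Proof. by case/and3P: (valP la). Qed.

Lemma part_pos (la : intpart n) : 0 \notin (la : seq nat).
Proof. by case/and3P: (valP la). Qed.

Lemma sumn_part (la : intpart n) : sumn la = n.
Proof. by case/and3P: (valP la) => _ _ /eqP. Qed.

Lemma size_le_sumn (s : seq nat) : 0 \notin s -> size s <= sumn s.
Proof. by elim: s => //= x s IH; rewrite inE negb_or => /andP[x0 /IH]; lia. Qed.

Lemma size_part (la : intpart n) : size la <= n.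
Proof. by have := size_le_sumn (part_pos la); rewrite sumn_part. Qed.

Lemma nth_le_sumn (s : seq nat) i : nth 0 s i <= sumn s.
Proof.
elim: s i => [|x s IH] [|i] //=; first exact: leq_addr.
by apply: leq_trans (IH i) (leq_addl _ _).
Qed.

Lemma box_seq_part_box la : box_seq (part_box la) = (la : seq nat) ++ nseq (n.+1 - size la) 0.
Proof.
have sz := size_part la.
have E : nth 0 ((la : seq nat) ++ nseq (n.+1 - size la) 0) =1 nth 0 la.
  move=> i; rewrite nth_cat nth_nseq; case: ltnP => // il.
  by rewrite nth_default //; case: ifP.
have -> : part_box la = mkbox n (nth 0 ((la : seq nat) ++ nseq (n.+1 - size la) 0)).
  apply: eq_box => i ni; have := nth_le_sumn la i; rewrite sumn_part => ln.
  by rewrite !bval_mkbox ?E.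
apply: mkbox_box_seq; first by rewrite size_cat size_nseq subnKC // ltnW.
by move=> i; rewrite E; have := nth_le_sumn la i; rewrite sumn_part.
Qed.

Lemma bval_part_box la i : bval (part_box la) i = nth 0 la i.
Proof.
rewrite -nth_box_seq box_seq_part_box nth_cat nth_nseq; case: ltnP => // il.
by rewrite nth_default //; case: ifP.
Qed.

Lemma part_box_inj : injective part_box.
Proof.
move=> la mu /(congr1 (fun p => [seq x <- box_seq p | 0 < x])).
rewrite !box_seq_part_box !filter_cat.
have F c : [seq x <- nseq c 0 | 0 < x] = [::] by elim: c.
have G (nu : intpart n) : [seq x <- (nu : seq nat) | 0 < x] = nu.
  apply/all_filterP/allP => x xn; rewrite lt0n; apply: contraNneq (part_pos nu) => <- //.
by rewrite !F !cats0 !G => /val_inj.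
Qed.

Lemma bsize_part_box la : bsize (part_box la) = n.
Proof. by rewrite -sumn_box_seq box_seq_part_box sumn_cat sumn_nseq mul0n addn0 sumn_part. Qed.

Lemma bval_part_box_decr la i : bval (part_box la) i.+1 <= bval (part_box la) i.
Proof.
rewrite !bval_part_box; case: (ltnP i.+1 (size la)) => il; last by rewrite nth_default.
by move/(sortedP 0): (part_sorted la) => /(_ i il).
Qed.

Lemma sorted_part_box la : sorted geq (box_seq (part_box la)).
Proof. by apply/sorted_box_seq => i; exact: bval_part_box_decr. Qed.

Lemma part_boxP (nu : box n) : (forall i, bval nu i.+1 <= bval nu i) -> bsize nu = n ->
  exists la, part_box la = nu.
Proof.
move/sorted_box_seq => s sz; pose la := [seq x <- box_seq nu | 0 < x].
have tr : transitive geq by move=> x y z xy yz; apply: leq_trans yz xy.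
have laP : is_part_of_nat n la.
  apply/and3P; split; first exact: sorted_filter.
    by rewrite mem_filter.
  rewrite -sz -sumn_box_seq /la; apply/eqP; elim: (box_seq nu) => //= x t <-.
  by case: x.
exists (IntPart laP); apply: eq_box => i _; rewrite bval_part_box -nth_box_seq /= /la.
elim: (box_seq nu) s i => //= x t IH xt i.
case: x xt => [|x] xt /=; last by case: i => //= i; apply: IH; apply: path_sorted xt.
have t0 : all (pred1 0) t.
  by move/(order_path_min tr): xt; apply: sub_all => y /=; rewrite leqn0.
have -> : [seq x <- t | 0 < x] = [::].
  by elim: t t0 {IH xt} => //= y t IH /andP[/eqP -> /IH].
rewrite nth_nil; case: i => //= i; apply/esym.
case: (ltnP i (size t)) => it; last by rewrite nth_default.
by apply/eqP/(all_nthP 0 t0).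
Qed.

Lemma kostka_rec_decr ra (nu : box n) : kostka_rec ra nu != 0%R ->
  forall i, bval nu i.+1 <= bval nu i.
Proof.
case: ra => [|a ra].
  rewrite /=; case: (bsize nu =P 0) => [nu0 _ i|_]; last by rewrite eqxx.
  by have := bval_le nu i.+1; rewrite nu0; lia.
move=> H i; case: (pickP [pred la : box n | hstrip la nu]) => [la /= h|N].
  exact: hstrip_decrr h.
case/negP: H; rewrite kostka_rec_cons big_pred0 // => la.
by have /= -> := N la.
Qed.

(** A new first row raises each nonempty column from [c] to [c.+1] cells, and 'C(c.+1, 2) = 'C(c, 2)
    + c. The increments add up to the size of [s], as does the shift of the row numbers of [s] by
    one. *)
Lemma sum_bin2_count (s : seq nat) m : sorted geq s -> head 0 s <= m ->
  \sum_(0 <= j < m) 'C(count (fun a => j < a) s, 2) = \sum_(i < size s) i * nth 0 s i.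
Proof.
elim: s m => [|a s IH] m; first by rewrite big_ord0 big1.
move=> /= pa am; rewrite big_ord_recl mul0n add0n.
under [RHS]eq_bigr => i _ do rewrite /= /bump /= add1n mulSn.
rewrite big_split /= -(IH m) ?(path_sorted pa) //; last first.
  by case: s pa {IH} => //= b s /andP[ba _]; apply: leq_trans ba am.
have tr : transitive geq by move=> x y z xy yz; apply: leq_trans yz xy.
have sa := order_path_min tr pa.
have -> : \sum_(i < size s) nth 0 s i = \sum_(0 <= j < m) count (fun x => j < x) s.
  rewrite -(big_mkord xpredT (nth 0 s)) -(big_nth 0 xpredT id).
  have : all (geq m) s by apply: sub_all sa => x /= /leq_trans; apply.
  elim: s {IH pa sa} => [|x s IH] /=; first by rewrite big_nil big1.
  case/andP=> xm sm; rewrite big_cons IH // big_split /=; congr (_ + _).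
  rewrite (big_cat_nat (n := x)) //= [X in _ + X]big_nat_cond [X in _ + X]big1 ?addn0.
    rewrite big_nat_cond (eq_bigr (fun=> 1)); last by move=> j /andP[/andP[_ ->]].
    by rewrite -big_nat_cond sum_nat_const_nat subn0 muln1.
  by move=> j /andP[/andP[xj _] _]; rewrite ltnNge xj.
rewrite -big_split; apply: eq_bigr => j _ /=.
case: ltnP => ja; first by rewrite add1n binS bin1 addnC.
have -> : count (fun x => j < x) s = 0.
  apply/eqP; rewrite eqn0Ngt -has_count; apply/hasPn => x /(allP sa) /= xa.
  by rewrite -leqNgt (leq_trans xa).
by [].
Qed.

Lemma bin2_conj_part (la : intpart n) : bin2_part (conj_part la) = row_exp (part_box la).
Proof.
rewrite /bin2_part /conj_part big_map.
have -> : iota 0 (head 0 la) = index_iota 0 (head 0 la) by rewrite /index_iota subn0.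
rewrite sum_bin2_count ?part_sorted // /row_exp.
rewrite -!(big_mkord xpredT (fun i => i * _ i)).
rewrite [RHS](big_cat_nat (n := size la)) //=; last by rewrite ltnW // ltnS size_part.
rewrite [X in _ = _ + X]big_nat_cond [X in _ = _ + X]big1 ?addn0.
  by apply: eq_bigr => i _; rewrite bval_part_box.
by move=> i /andP[/andP[li _] _]; rewrite bval_part_box nth_default // muln0.
Qed.

(** The zeros padding a box become empty rows at the bottom, invisible to columns, content and row
    word. *)
Lemma tableaux_pad (la al : seq nat) z :
  perm_eq (tableaux (la ++ nseq z 0) al) [seq T ++ nseq z [::] | T <- tableaux la al].
Proof.
have fE j : flatten (nseq j ([::] : seq nat)) = [::] by elim: j.
have cE T j : column (T ++ nseq z [::]) j = column T j.
  rewrite /column filter_cat map_cat (_ : [seq r <- nseq z _ | _] = [::]) ?cats0 //.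
  by elim: z.
have E T : semistandard (T ++ nseq z [::]) = semistandard T.
  rewrite /semistandard flatten_cat fE cats0 all_cat.
  rewrite (_ : all _ (nseq z [::])) ?andbT; last by apply/allP => x /nseqP[->].
  have -> : head 0 (shape (T ++ nseq z [::])) = head 0 (shape T).
    by case: T => //=; case: z {cE}.
  by congr [&& _, _ & _]; apply: eq_all => j; rewrite cE.
have C T : content (T ++ nseq z [::]) = content T by rewrite /content flatten_cat fE cats0.
have sE T : shape (T ++ nseq z [::]) = shape T ++ nseq z 0.
  by rewrite /shape map_cat map_nseq.
apply: uniq_perm; first exact: uniq_tableaux.
  rewrite map_inj_in_uniq ?uniq_tableaux // => T T' _ _ TT'.
  have sz : size T = size T' by move/(congr1 size): TT'; rewrite !size_cat size_nseq; lia.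
  by move: TT' => /eqP; rewrite eqseq_cat // => /andP[/eqP].
move=> T; rewrite mem_tableaux; apply/and3P/mapP => [[sT /eqP shT cT]|[T' + ->]].
  have TE : T = take (size la) T ++ nseq z [::].
    rewrite -{1}(cat_take_drop (size la) T); congr (_ ++ _).
    have : shape (drop (size la) T) = nseq z 0 by rewrite /shape map_drop -/(shape T) shT drop_size_cat.
    elim: z (drop _ _) {shT fE cE E C sE} => [|z IH] [|r T'] //= [/size0nil -> /IH ->] //.
  exists (take (size la) T) => //; rewrite mem_tableaux -E -C -TE sT cT /= andbT.
  by rewrite /shape map_take -/(shape T) shT take_size_cat.
rewrite mem_tableaux E C sE => /and3P[-> /eqP -> ->]; by rewrite eqxx.
Qed.

Local Open Scope ring_scope.

Lemma sum_tableaux_part (la : intpart n) al : 0%N \notin al ->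
  \sum_(T <- tableaux la al) tableau_sign T = kostka_rec (rev al) (part_box la).
Proof.
move=> al0; rewrite -sum_tableaux_sign ?sorted_part_box // box_seq_part_box.
rewrite (perm_big _ (tableaux_pad _ _ _)) big_map; apply: eq_bigr => T _.
rewrite /tableau_sign /row_word rev_cat rev_nseq flatten_cat.
by rewrite (_ : flatten (nseq _ _) = [::]) //; elim: (_ - _)%N.
Qed.

(** Nonzero terms come from weakly decreasing boxes of size [n], which are the padded partitions of
    [n]. *)
Lemma kostka_pairing_parts ra rb : sumn ra = n ->
  kostka_pairing n ra rb = \sum_(la : intpart n) (-1) ^+ bin2_part (conj_part la)
    * kostka_rec ra (part_box la) * kostka_rec rb (part_box la).
Proof.
move=> ran; rewrite /kostka_pairing.
rewrite (bigID (mem [set part_box la | la : intpart n])) /= addrC big1 ?add0r.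
  rewrite big_imset /=; last by move=> la mu _ _; apply: part_box_inj.
  by apply: eq_bigr => la _; rewrite bin2_conj_part.
move=> nu /imsetP N; have [->|H] := eqVneq (kostka_rec ra nu) 0; first by rewrite mulr0 mul0r.
case: N; have [||la <-] := @part_boxP nu; last by exists la.
  exact: kostka_rec_decr H.
by rewrite (kostka_rec_size H).
Qed.

(** * Unitriangularity for the dominance order *)

Lemma sum_le_eq (F G : nat -> nat) N : (forall i, i < N -> F i <= G i)%N ->
  (\sum_(i < N) G i <= \sum_(i < N) F i)%N -> forall i, (i < N)%N -> F i = G i.
Proof.
elim: N => // N IH FG; rewrite !big_ord_recr /= => S i.
have S' : (\sum_(i < N) F i <= \sum_(i < N) G i)%N.
  by apply: leq_sum => j _; apply: FG; apply: ltnW (ltn_ord j).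
have FGN := FG N (ltnSn N).
have aux a b c d : (b + d <= a + c -> a <= b -> c <= d -> c = d /\ b <= a)%N by lia.
have [E1 E2] := aux _ _ _ _ S S' FGN.
rewrite ltnS leq_eqVlt => /orP[/eqP -> //|].
by apply: IH => // j jN; apply: FG; apply: ltnW.
Qed.

(** A horizontal strip adds at most one row. *)
Lemma kostka_rec_rows ra (nu : box n) i : kostka_rec ra nu != 0 -> (size ra <= i)%N ->
  bval nu i = 0%N.
Proof.
elim: ra nu i => [|a ra IH] nu i.
  rewrite /=; case: (bsize nu =P 0%N) => [nu0 _ _|_]; last by rewrite eqxx.
  by have := bval_le nu i; rewrite nu0; lia.
case: i => // i; rewrite [(_ <= _)%N]/= => H ri.
apply/eqP; apply: contraNT H => nui.
rewrite kostka_rec_cons big1 // => la /andP[/hstripP h _].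
have [->|/IH E] := eqVneq (kostka_rec ra la) 0; first by rewrite mulr0.
by case/negP: nui; rewrite -leqn0 -(E i ri); case: (h i).
Qed.

(** The first [j] letters lie in the first [j] rows; [rev ra] lists their multiplicities in
    increasing order of letters. *)
Lemma kostka_rec_dominance ra (nu : box n) j : kostka_rec ra nu != 0 ->
  (sumn (take j (rev ra)) <= bpre nu j)%N.
Proof.
elim: ra nu => [|a ra IH] nu H; first by rewrite take_oversize.
case: (leqP j (size ra)) => jr; last first.
  rewrite take_oversize ?size_rev // sumn_rev -(kostka_rec_size H).
  rewrite /bsize /bpre -!(big_mkord xpredT (bval nu)).
  case: (leqP j n.+1) => jn; last by rewrite [leqRHS](big_cat_nat (n := n.+1)) ?leq_addr // ltnW.
  rewrite (big_cat_nat (n := j)) //= [X in (_ + X <= _)%N]big_nat_cond.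
  rewrite [X in (_ + X <= _)%N]big1 ?addn0 // => i /andP[/andP[ji _] _].
  by apply: kostka_rec_rows H _; apply: leq_trans ji.
rewrite rev_cons -cats1 takel_cat ?size_rev //.
apply: contraNT H; rewrite -ltnNge => lt.
rewrite kostka_rec_cons big1 // => la /andP[/hstripP h _].
have [->|/IH E] := eqVneq (kostka_rec ra la) 0; first by rewrite mulr0.
move: lt; rewrite ltnNge (leq_trans E) // /bpre.
by apply: leq_sum => i _; case: (h i).
Qed.

Lemma bval_mkbox_seq (s : seq nat) i : (size s <= n)%N -> (sumn s <= n)%N ->
  bval (mkbox n (nth 0%N s)) i = nth 0%N s i.
Proof.
move=> sz sn; case: (leqP i n) => ni; last by rewrite bval_out // nth_default // ltnW // (leq_ltn_trans sz).
by rewrite bval_mkbox // (leq_trans (nth_le_sumn s i)).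
Qed.

Lemma bsize_mkbox_seq (s : seq nat) : (size s <= n)%N -> (sumn s <= n)%N ->
  bsize (mkbox n (nth 0%N s)) = sumn s.
Proof.
move=> sz sn; rewrite /bsize; under eq_bigr => i _ do rewrite bval_mkbox_seq //.
rewrite -(big_mkord xpredT (nth 0%N s)) (big_cat_nat (n := size s)) //=; last exact: leqW.
rewrite [X in (_ + X)%N]big_nat_cond [X in (_ + X)%N]big1 ?addn0; last first.
  by move=> i /andP[/andP[si _] _]; rewrite nth_default.
by rewrite sumnE [RHS](big_nth 0%N).
Qed.

(** The value is a sign, stated through its square: the only strip that contributes is the whole
    last row. *)
Lemma kostka_rec_diag (s : seq nat) : sorted geq s -> 0%N \notin s -> (sumn s <= n)%N ->
  kostka_rec (rev s) (mkbox n (nth 0%N s)) ^+ 2 = 1.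
Proof.
elim/last_ind: s => [|s a IH] ss s0 sn.
  rewrite /= (_ : bsize _ = 0%N) ?eqxx ?expr1n // /bsize big1 // => i _.
  by rewrite bval_mkbox_seq ?nth_nil.
have sz := leq_trans (size_le_sumn s0) sn.
have s0' : 0%N \notin s by move: s0; rewrite mem_rcons inE negb_or => /andP[].
have sn' : (sumn s <= n)%N by move: sn; rewrite sumn_rcons; lia.
have sz' := leq_trans (size_le_sumn s0') sn'.
have ss' : sorted geq s by move: ss; rewrite -cats1 => /cat_sorted2[].
rewrite rev_rcons kostka_rec_cons (bigD1 (mkbox n (nth 0%N s))) /=; last first.
  rewrite !bsize_mkbox_seq // sumn_rcons eqxx andbT; apply/hstripP => i.
  rewrite !bval_mkbox_seq // !nth_rcons; split.
    by case: ltnP => // si; rewrite nth_default.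
  case: (ltnP i.+1 (size s)) => si; first by move/(sortedP 0%N): ss' => /(_ i si).
  case: eqP => // Ei; have iS : (i.+1 < size (rcons s a))%N by rewrite size_rcons Ei.
  by move/(sortedP 0%N): ss => /(_ i iS); rewrite !nth_rcons Ei ltnn eqxx -Ei ltnSn.
rewrite big1 ?addr0; first by rewrite exprMn IH // sqrr_sign mulr1.
move=> la /andP[/andP[/hstripP h /eqP sla] ne].
(* Any other [la] with nonzero coefficient has at most [size s] rows, hence lies inside [s], and it
   has the same size. *)
have [->|H] := eqVneq (kostka_rec (rev s) la) 0; first by rewrite mulr0.
case/eqP: ne; apply: eq_box => i ni.
apply: (sum_le_eq (N := n.+1)) => // [j jn|].
  rewrite bval_mkbox_seq //; have := h j; rewrite bval_mkbox_seq // nth_rcons.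
  case: ltnP => js [] //.
  by rewrite (kostka_rec_rows H) ?size_rev.
by rewrite -!/(bsize _) (kostka_rec_size H) sumn_rev bsize_mkbox_seq.
Qed.

(** The sum [f] of all prefix sums is strictly monotone for dominance, so the shapes are treated by
    decreasing [f]. The diagonal coefficient squares to 1 and can be cancelled in any ring. *)
Lemma kostka_rec_inj (k : pzRingType) (x : intpart n -> k) :
  (forall mu : intpart n,
     \sum_(la : intpart n) (kostka_rec (rev mu) (part_box la))%:~R * x la = 0) ->
  forall la, x la = 0.
Proof.
move=> H; pose f (la : intpart n) := (\sum_(j < n.+2) bpre (part_box la) j)%N.
have fle la : (f la <= n.+2 * n)%N.
  rewrite -[in leqRHS](card_ord n.+2) -sum_nat_const; apply: leq_sum => j _.
  by have := bpre_le (part_box la) j; rewrite bsize_part_box.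
suff P m : forall la, (n.+2 * n - f la < m)%N -> x la = 0.
  by move=> la; apply: P (ltnSn _).
elim: m => // m IH mu fm; have := H mu.
rewrite (bigD1 mu) //= big1 ?addr0 => [E|la ne].
  have := kostka_rec_diag (part_sorted mu) (part_pos mu); rewrite sumn_part => /(_ (leqnn _)) K1.
  by rewrite -[x mu]mul1r -[1]/(1%:~R) -K1 expr2 intrM -mulrA E mulr0.
have [->|K0] := eqVneq (kostka_rec (rev mu) (part_box la)) 0; first by rewrite mul0r.
have dom j : (bpre (part_box mu) j <= bpre (part_box la) j)%N.
  apply: leq_trans (kostka_rec_dominance j K0); rewrite revK.
  elim: j => [|j IHj]; first by rewrite bpre0.
  rewrite bpreS bval_part_box; case: (ltnP j (size mu)) => jm.
    by rewrite (take_nth 0%N jm) sumn_rcons leq_add2r.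
  by rewrite nth_default // addn0 (leq_trans IHj) // !take_oversize // ltnW.
rewrite [x la]IH ?mulr0 //.
(* Otherwise all prefix sums of [mu] and [la] agree, and so do the parts. *)
have : (f mu < f la)%N.
  rewrite ltnNge; apply: contra_neqN ne => le.
  apply: part_box_inj; apply: eq_box => i ni.
  have E := sum_le_eq (fun j _ => dom j) le.
  have i2 : (i.+1 < n.+2)%N by rewrite ltnS.
  have := E i.+1 i2; have := E i (ltnW i2).
  by rewrite !bpreS; lia.
by have := fle la; have := fle mu; lia.
Qed.

End PartitionBoxes.

(** * Coxeter length *)

Section CoxeterLength.
Local Open Scope nat_scope.
Local Open Scope group_scope.
Variable n : nat.
Implicit Types w : 'S_n.

Definition inv_count w : nat :=
  #|[set p : 'I_n * 'I_n | (p.1 < p.2) && (w p.2 < w p.1)]|.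

(** Exchanging the positions [i] and [j] maps the inversions of [tperm i j * w] bijectively to those
    of [w] other than [(i, j)], since no position lies strictly between the two. *)
Lemma inv_count_descent w (i j : 'I_n) : j = i.+1 :> nat -> w j < w i ->
  inv_count w = (inv_count (tperm i j * w)).+1.
Proof.
move=> ij wji; rewrite /inv_count.
pose D := [set p : 'I_n * 'I_n | (p.1 < p.2) && (w p.2 < w p.1)]; rewrite -/D.
pose s := tperm i j; pose f (p : 'I_n * 'I_n) := (s p.1, s p.2).
have fK : involutive f by case=> x y; rewrite /f /= !tpermK.
have Dij : (i, j) \in D by rewrite inE /= wji ij ltnSn.
rewrite (cardsD1 (i, j)) Dij add1n -(card_preimset _ (inv_inj fK)); congr _.+1.
apply: eq_card => -[x y]; rewrite !inE /= !permM xpair_eqE.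
have W (a b : 'I_n) : a != b -> (w a < w b) = ~~ (w b < w a).
  by move=> ab; rewrite -leqNgt ltn_neqAle (inj_eq val_inj) (inj_eq perm_inj) ab.
rewrite -/s; case: (ltnP (w (s y)) (w (s x))) => H; last by rewrite !andbF.
rewrite !andbT; move: H; rewrite /s.
case: tpermP => [->|->|/eqP xi /eqP xj]; case: tpermP => [->|->|/eqP yi /eqP yj];
  rewrite ?eqxx -?val_eqE /= ?ltnn //; move: wji; rewrite ?ij;
  try (move: xi xj); try (move: yi yj); rewrite -?val_eqE /= ?ij; lia.
Qed.

Lemma inv_count1 : inv_count 1 = 0.
Proof.
apply/eqP; rewrite cards_eq0; apply/eqP/setP => -[x y]; rewrite !inE !perm1 /=.
by apply/negbTE; lia.
Qed.

Lemma inv_count_tperm w (i j : 'I_n) : j = i.+1 :> nat ->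
  inv_count (tperm i j * w) <= (inv_count w).+1.
Proof.
move=> ij; case: (ltngtP (w j) (w i)) => H.
- by rewrite [in leqRHS](inv_count_descent ij H) ltnW // ltnW.
- rewrite (@inv_count_descent (tperm i j * w) i j) //; last by rewrite !permM tpermL tpermR.
  by rewrite mulgA tperm2 mul1g.
by move/val_inj/perm_inj: H => H; move: ij; rewrite H; lia.
Qed.

(** An increasing permutation satisfies [i <= w i], and so does its inverse. *)
Lemma increasing_perm1 w : (forall i j : 'I_n, j = i.+1 :> nat -> w i < w j) -> w = 1.
Proof.
move=> H.
have ge (v : 'S_n) : (forall i j : 'I_n, i < j -> v i < v j) -> forall i : 'I_n, i <= v i.
  move=> Hv [i iN]; elim: i iN => // i IH iN.
  by apply: leq_ltn_trans (IH (ltnW iN)) _; apply: Hv => /=.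
have incr (i j : 'I_n) : i < j -> w i < w j.
  case: i => i iN; case: j => j; elim: j => // j IH jN /=.
  rewrite ltnS leq_eqVlt => /orP[/eqP E|ij].
    by apply: H; rewrite /= E.
  by apply: ltn_trans (IH (ltnW jN) ij) _; apply: H.
apply/permP => i; apply/val_inj; rewrite perm1; apply/eqP.
rewrite eqn_leq ge // andbT -[leqRHS](congr1 val (permK w i)); apply: ge => x y xy.
rewrite ltnNge; apply/negP; rewrite leq_eqVlt => /orP[/eqP/val_inj/perm_inj E|/incr].
  by move: xy; rewrite E ltnn.
by rewrite !permKV ltnNge ltnW.
Qed.

Lemma mem_simple_transp (i j : 'I_n) : j = i.+1 :> nat -> tperm i j \in simple_transp n.
Proof. by move=> ij; apply/imsetP; exists (i, j); rewrite ?inE //=; apply/eqP. Qed.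

(** A simple transposition raises the number of inversions by at most one, and a permutation other
    than 1 has a descent, at which the number drops by one. *)
Lemma coxeter_lengthE w : coxeter_length w = inv_count w.
Proof.
have up k : forall v : 'S_n, v \in simple_transp n ^+ k -> inv_count v <= k.
  elim: k => [|k IH] v; first by rewrite expg0 inE => /eqP ->; rewrite inv_count1.
  rewrite expgS => /mulsgP[x y /imsetP[[i j]]]; rewrite inE /= => /eqP ij -> /IH Hy ->.
  by apply: leq_trans (inv_count_tperm _ ij) _.
have down m : forall v : 'S_n, inv_count v = m -> v \in simple_transp n ^+ m.
  elim: m => [|m IH] v vm.
    rewrite expg0 inE; apply/eqP/increasing_perm1 => i j ij.
    case: (ltngtP (v i) (v j)) => // [H|/val_inj/perm_inj E].
      by move: (inv_count_descent ij H); rewrite vm.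
    by move: ij; rewrite E; lia.
  have [[i j] /= /andP[/eqP ij H]|N] :=
      pickP [pred p : 'I_n * 'I_n | (p.2 == p.1.+1 :> nat) && (v p.2 < v p.1)].
    rewrite (_ : v = tperm i j * (tperm i j * v)); last by rewrite mulgA tperm2 mul1g.
    rewrite expgS mem_mulg ?mem_simple_transp // IH //.
    by move: (inv_count_descent ij H); rewrite vm => -[].
  suff v1 : v = 1 by move: vm; rewrite v1 inv_count1.
  apply: increasing_perm1 => i j ij; have /= := N (i, j); rewrite ij eqxx /=.
  case: (ltngtP (v i) (v j)) => // /val_inj/perm_inj E.
  by move: ij; rewrite E; lia.
rewrite /coxeter_length; case: ex_minnP => k wk mk.
by apply/eqP; rewrite eqn_leq mk ?down //= up.
Qed.

(** A descent inside a block could be removed by a transposition that shortens [w]. *)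
Lemma increasing_on_blocks w (blk : nat -> nat) : {homo blk : i j / i <= j} ->
  (forall i j : 'I_n, j = i.+1 :> nat -> blk i = blk j ->
     coxeter_length w <= coxeter_length (tperm i j * w)) ->
  forall i j : 'I_n, i < j -> blk i = blk j -> w i < w j.
Proof.
move=> mono H.
have step (i j : 'I_n) : j = i.+1 :> nat -> blk i = blk j -> w i < w j.
  move=> ij bij; have := H i j ij bij; rewrite !coxeter_lengthE.
  case: (ltngtP (w i) (w j)) => // [G|/val_inj/perm_inj E _].
    by rewrite [in leqLHS](inv_count_descent ij G) ltnn.
  by move: ij; rewrite E; lia.
move=> [i iN] [j]; elim: j => // j IH jN /=.
rewrite ltnS leq_eqVlt => /orP[/eqP E|ij] bij.
  by apply: step; rewrite //= E.
have bj : blk i = blk j.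
  have := mono i j (ltnW ij); have := mono j j.+1 (leqnSn j); rewrite -bij; lia.
apply: ltn_trans (IH (ltnW jN) ij bj) _; apply: step => //=; congruence.
Qed.

End CoxeterLength.

(** * Sorted block words *)

Section BlockWords.
Local Open Scope nat_scope.

(* Compositions are listed backwards, so that the letter of a block is the number of parts
   after it in the list. *)
Fixpoint block_word (ra : seq nat) : seq nat :=
  if ra is a :: ra' then block_word ra' ++ nseq a (size ra') else [::].

(** Words of content [ra] sorted on the blocks of [rb]: the last block takes [io] copies of the
    letters, in sorted order, and the rest is chosen recursively. *)
Fixpoint block_words (ra rb : seq nat) : seq (seq nat) :=
  if rb is b :: rb' then
    [seq v ++ block_word io | io <- subcomps b ra, v <- block_words (subw ra io) rb']
  else if sumn ra == 0 then [:: [::]] else [::].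

Definition block_sorted (rb v : seq nat) : Prop :=
  forall i j, i < j -> j < size v -> nth 0 (block_word rb) i = nth 0 (block_word rb) j ->
    nth 0 v i <= nth 0 v j.

Lemma size_block_word ra : size (block_word ra) = sumn ra.
Proof. by elim: ra => //= a ra IH; rewrite size_cat size_nseq IH addnC. Qed.

Lemma mem_block_word ra x : x \in block_word ra -> x < size ra.
Proof.
by elim: ra => //= a ra IH; rewrite mem_cat => /orP[/IH/leqW|/nseqP[-> _]].
Qed.

Lemma sorted_block_word ra : sorted leq (block_word ra).
Proof.
rewrite (sorted_pairwise leq_trans); elim: ra => //= a ra IH.
rewrite pairwise_cat IH /=; apply/andP; split.
  by apply/allrelP => x y /mem_block_word xr /nseqP[-> _]; apply: ltnW.
by elim: a => //= a ->; rewrite andbT; apply/allP => y /nseqP[->].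
Qed.

Lemma size_subw ra io : size io = size ra -> size (subw ra io) = size ra.
Proof. by move=> s; rewrite size_map size_zip s minnn. Qed.

Lemma perm_block_word_subw ra io : size io = size ra -> all2 leq io ra ->
  perm_eq (block_word (subw ra io) ++ block_word io) (block_word ra).
Proof.
elim: ra io => [|a ra IH] [|i io] //= [s] /andP[ia l].
rewrite -/(subw ra io) size_subw // s.
rewrite (perm_catACA) .
have -> : nseq a (size ra) = nseq (a - i) (size ra) ++ nseq i (size ra).
  by rewrite -nseqD subnK.
by apply: perm_cat (perm_refl _); apply: IH.
Qed.

(** The inversions between the last block and the letters before it give the sign of the operator
    recursion: the [a - i] remaining copies of the largest letter exceed the [sumn io'] smaller
    letters of the last block. *)
Lemma cross_block_word ra io : size io = size ra ->
  cross_inv (block_word (subw ra io)) (block_word io) = cross_exp ra io.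
Proof.
elim: ra io => [|a ra IH] [|i io] //= [s].
rewrite -/(subw ra io) size_subw // s !cross_inv_catl !cross_inv_catr IH //.
rewrite (@cross_inv_full (nseq _ _) (block_word io)); last first.
  by move=> x y /nseqP[-> _] /mem_block_word; rewrite s.
rewrite (@cross_inv0 (block_word _) (nseq _ _)); last first.
  by move=> x y /mem_block_word + /nseqP[-> _]; rewrite size_subw // => /ltnW.
rewrite (@cross_inv0 (nseq _ _) (nseq _ _)); last first.
  by move=> x y /nseqP[-> _] /nseqP[-> _].
by rewrite size_nseq size_block_word; lia.
Qed.

Lemma block_word_inj io io' : size io = size io' -> block_word io = block_word io' -> io = io'.
Proof.
elim: io io' => [|i io IH] [|i' io'] //= [s] E.
have cE jo c : count_mem (size jo) (block_word jo ++ nseq c (size jo)) = c.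
  rewrite count_cat count_nseq /= eqxx mul1n (_ : count_mem _ _ = 0) //.
  apply/eqP; rewrite eqn0Ngt -has_count; apply/hasPn => x /mem_block_word /=.
  by rewrite ltn_neqAle => /andP[].
have ii' : i = i' by rewrite -(cE io i) E s cE.
have sz : size (block_word io) = size (block_word io').
  by move/(congr1 size): E; rewrite !size_cat !size_nseq ii'; lia.
rewrite ii' (IH io') //; move/eqP: E; rewrite ii' s eqseq_cat //.
by case/andP=> /eqP.
Qed.

Lemma block_word_split ra u : (forall x, x \in u -> x < size ra) ->
  (forall x, count_mem x u <= count_mem x (block_word ra)) ->
  exists io, [/\ size io = size ra, all2 leq io ra & perm_eq u (block_word io)].
Proof.
elim: ra u => [|a ra IH] u Hs Hc.
  exists [::]; split => //; case: u Hs {Hc} => // x u /(_ x (mem_head _ _)) //.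
pose s := size ra; pose u' := [seq x <- u | x != s].
have [|x|io [sio lio pio]] := IH u'.
- by move=> x; rewrite mem_filter => /andP[xs /Hs]; rewrite ltnS leq_eqVlt (negPf xs).
- have := Hc x; rewrite /= count_cat count_nseq count_filter.
  have [->|xs] := eqVneq x s; first by move=> _; rewrite (@eq_count _ _ pred0) ?count_pred0 // => y /=; case: (y == s).
  rewrite (_ : pred1 x s = false) ?mul0n ?addn0; last by rewrite /= eq_sym (negPf xs).
  by apply: leq_trans; apply: sub_count => y /= /andP[].
exists (count_mem s u :: io); split => /=; first by rewrite sio.
- rewrite lio andbT; have := Hc s; rewrite /= count_cat count_nseq /= eqxx mul1n.
  rewrite (_ : count_mem s (block_word ra) = 0) // .
  apply/eqP; rewrite eqn0Ngt -has_count; apply/hasPn => x /mem_block_word /=.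
  by rewrite ltn_neqAle => /andP[].
have pF : perm_eq u (u' ++ [seq x <- u | ~~ (x != s)]) by rewrite perm_sym perm_filterC.
apply: perm_trans pF _; rewrite sio; apply: perm_cat pio _.
have /all_pred1P E : all (pred1 s) [seq x <- u | ~~ (x != s)].
  by apply/allP => x; rewrite mem_filter negbK => /andP[].
rewrite E size_filter (eq_count (a2 := pred1 s)) // => x.
by rewrite /= negbK.
Qed.

Lemma block_words_perm ra rb v : v \in block_words ra rb -> perm_eq v (block_word ra).
Proof.
elim: rb ra v => [|b rb IH] ra v /=.
  case: eqP => // ra0; rewrite inE => /eqP ->.
  by rewrite (_ : block_word ra = [::]) //; apply: size0nil; rewrite size_block_word.
case/allpairsPdep=> io [u [+ /IH pu ->]]; rewrite mem_subcomps => /and3P[/eqP sio lio _].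
by apply: perm_trans (perm_block_word_subw sio lio); rewrite perm_cat2r.
Qed.

Lemma block_words_sumn ra rb v : v \in block_words ra rb -> size v = sumn ra.
Proof. by move/block_words_perm/perm_size; rewrite size_block_word. Qed.

Lemma mem_block_words ra rb v : sumn rb = sumn ra ->
  v \in block_words ra rb <-> perm_eq v (block_word ra) /\ block_sorted rb v.
Proof.
elim: rb ra v => [|b rb IH] ra v /= rab.
  rewrite -rab eqxx inE; split=> [/eqP ->|[/perm_size + _]].
    split; last by [].
    by rewrite (_ : block_word ra = [::]) //; apply: size0nil; rewrite size_block_word -rab.
  by rewrite size_block_word -rab => /size0nil ->.
split.
  case/allpairsPdep=> io [u [+ uW ->]]; rewrite mem_subcomps => /and3P[/eqP sio lio /eqP iob].
  have subE := sumn_subw sio lio.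
  have rs : sumn rb = sumn (subw ra io) by lia.
  have [pu su] := (IH _ _ rs).1 uW.
  have zu : size u = sumn rb by rewrite (block_words_sumn uW).
  split.
    apply: perm_trans (perm_block_word_subw sio lio).
    by rewrite perm_cat2r.
  move=> i j ij; rewrite size_cat zu size_block_word => jv /=.
  rewrite !nth_cat size_block_word zu.
  case: (ltnP i (sumn rb)) => ib; case: (ltnP j (sumn rb)) => jb //=; last 2 first.
  - lia.
  - by move=> _; apply: (sorted_leq_nth leq_trans leqnn 0 (sorted_block_word io));
       rewrite ?inE ?size_block_word; lia.
  - by apply: su; rewrite ?zu.
  rewrite nth_nseq (_ : j - sumn rb < b); last by lia.
  (* Positions in an earlier block and in the last one never carry the same block letter. *)
  move=> E; have : nth 0 (block_word rb) i \in block_word rb by rewrite mem_nth ?size_block_word.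
  by move/mem_block_word; rewrite E ltnn.
case=> pv sv; have zv : size v = sumn rb + b by rewrite (perm_size pv) size_block_word -rab addnC.
(* Conversely, the last block [t] is sorted, hence determined by its letter multiplicities [io]. *)
pose u := take (sumn rb) v; pose t := drop (sumn rb) v.
have zu : size u = sumn rb by rewrite size_takel // zv leq_addr.
have zt : size t = b by rewrite size_drop zv addKn.
have vE : v = u ++ t by rewrite cat_take_drop.
have st : sorted leq t.
  apply/(sortedP 0) => i; rewrite zt => iz; rewrite !nth_drop; apply: sv; rewrite ?zv; try lia.
  rewrite /= !nth_cat size_block_word !ltnNge !leq_addr /= !nth_nseq !addKn.
  by rewrite iz (ltnW iz).
have [x xt|x|io [sio lio pt]] := @block_word_split ra t.
- by apply: mem_block_word; rewrite -(perm_mem pv) vE mem_cat xt orbT.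
- by move/seq.permP: pv => <-; rewrite vE count_cat leq_addl.
have tE : t = block_word io.
  by apply: (sorted_eq leq_trans anti_leq) pt => //; apply: sorted_block_word.
have iob : sumn io = b by rewrite -size_block_word -tE.
have subE := sumn_subw sio lio.
apply/allpairsPdep; exists io, u; split; last by rewrite -tE.
  by rewrite mem_subcomps sio lio iob !eqxx.
apply/IH; first by lia.
split.
  rewrite -(perm_cat2r (block_word io)) perm_sym.
  by apply: perm_trans (perm_block_word_subw sio lio) _; rewrite -tE -vE perm_sym.
move=> i j ij ju E; have jv : j < size v by rewrite zv -zu ltn_addr.
have iu := ltn_trans ij ju.
have := sv i j ij jv; rewrite vE !nth_cat ju iu; apply.
by rewrite size_block_word -zu ju iu.
Qed.

Lemma uniq_block_words ra rb : uniq (block_words ra rb).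
Proof.
elim: rb ra => [|b rb IH] ra /=; first by case: eqP.
apply: allpairs_uniq_dep => [|io _|]; [exact: uniq_subcomps | exact: IH |].
move=> _ _ /allpairsPdep[io [u [ioP uW ->]]] /allpairsPdep[io' [u' [ioP' uW' ->]]] /= E.
move: ioP ioP'; rewrite !mem_subcomps.
case/and3P=> /eqP sio lio /eqP iob /and3P[/eqP sio' lio' /eqP iob'].
have S := sumn_subw sio lio; have S' := sumn_subw sio' lio'.
have zu := block_words_sumn uW; have zu' := block_words_sumn uW'.
have sz : size u = size u' by lia.
move/eqP: E; rewrite eqseq_cat // => /andP[/eqP Eu /eqP/block_word_inj Eio].
by rewrite Eu Eio // sio sio'.
Qed.

Local Open Scope ring_scope.

(** Both sides satisfy the recursion of [kostka_pairing_cons]. *)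
Lemma sum_block_words n ra rb : (sumn ra <= n)%N ->
  \sum_(v <- block_words ra rb) (-1) ^+ seq_inv v = kostka_pairing n ra rb.
Proof.
elim: rb ra => [|b rb IH] ra ran.
  by rewrite kostka_pairing_nil /=; case: eqP => _; rewrite ?big_nil ?big_seq1.
rewrite kostka_pairing_cons // big_allpairs_dep /= big_seq [RHS]big_seq.
apply: eq_bigr => io; rewrite mem_subcomps => /and3P[/eqP sio lio _].
have S := sumn_subw sio lio.
rewrite -IH; last by lia.
rewrite big_distrr /= big_seq [RHS]big_seq; apply: eq_bigr => v vW.
have pv := block_words_perm (vW : v \in block_words (subw ra io) rb).
rewrite seq_inv_cat (seq_inv_sorted (sorted_block_word io)) addn0.
by rewrite (perm_cross_inv pv (perm_refl _)) cross_block_word // exprD mulrC.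
Qed.

End BlockWords.

(** * Double cosets of Young subgroups *)

Section YoungCosets.
Local Open Scope nat_scope.
Local Open Scope group_scope.

Lemma reshape_index_block_word al i : i < sumn al ->
  reshape_index al i = nth 0 (block_word (rev al)) i.
Proof.
move=> ial; pose ss := [seq nseq (nth 0 al j) j | j <- iota 0 (size al)].
have sE : shape ss = al.
  apply: (@eq_from_nth _ 0); rewrite !size_map size_iota // => j jal.
  by rewrite /shape -map_comp (nth_map 0) ?size_iota //= nth_iota // size_nseq.
have -> : block_word (rev al) = flatten ss.
  rewrite {sE ial}/ss; elim/last_ind: al => // al a IH.
  rewrite rev_rcons /= IH size_rev size_rcons -[in RHS](addn1 (size al)) iotaD map_cat.
  rewrite flatten_cat /= cats0 nth_rcons ltnn eqxx; congr (flatten _ ++ _).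
  by apply/eq_in_map => j; rewrite mem_iota /= nth_rcons => ->.
rewrite nth_flatten sE.
have r_lt := reshape_indexP ial; have o_lt := reshape_offsetP ial.
by rewrite (nth_map 0) ?size_iota // nth_iota // nth_nseq o_lt.
Qed.

Lemma reshape_index_mono al : {homo reshape_index al : i j / i <= j}.
Proof. by move=> i j; rewrite (reshape_leq al) => /orP[/ltnW|/andP[/eqP -> _]]. Qed.

Variables (n : nat) (al be : seq nat).

Lemma young_subgroup1 : 1 \in young_subgroup n al.
Proof. by rewrite inE; apply/forallP => i; rewrite perm1. Qed.

Lemma young_subgroupM x y : x \in young_subgroup n al -> y \in young_subgroup n al ->
  x * y \in young_subgroup n al.
Proof.
rewrite !inE => /forallP Hx /forallP Hy; apply/forallP => i.
by rewrite permM (eqP (Hy (x i))) Hx.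
Qed.

Lemma young_subgroup_inv x : x \in young_subgroup n al -> x^-1 \in young_subgroup n al.
Proof. by rewrite -{2}young_subgroupV memV_invg. Qed.

Lemma young_subgroup_tperm (i j : 'I_n) : reshape_index al i = reshape_index al j ->
  tperm i j \in young_subgroup n al.
Proof.
move=> ij; rewrite inE; apply/forallP => x.
by case: tpermP => [->|->|_ _]; rewrite ?ij.
Qed.

Definition dcoset (w : 'S_n) : {set 'S_n} := young_subgroup n be :* w * young_subgroup n al.

Lemma dcosetP w x : reflect (exists y z, [/\ y \in young_subgroup n be,
  z \in young_subgroup n al & x = y * w * z]) (x \in dcoset w).
Proof.
apply: (iffP mulsgP) => [[u z /rcosetP[y yB ->] zA ->]|[y [z [yB zA ->]]]].
  by exists y, z.
by exists (y * w) z => //; apply/rcosetP; exists y.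
Qed.

End YoungCosets.

(** * Minimal double coset representatives as block-sorted words *)

Section DoubleCosetSum.
Local Open Scope nat_scope.
Local Open Scope group_scope.
Variables (n : nat) (al be : seq nat).
Hypotheses (aln : sumn al = n) (ben : sumn be = n).
Local Notation dcoset := (@dcoset n al be).

Lemma dcoset_refl w : w \in dcoset w.
Proof.
by apply/dcosetP; exists 1, 1; split; rewrite ?young_subgroup1 // mul1g mulg1.
Qed.

Lemma dcoset_eq w x : x \in dcoset w -> dcoset x = dcoset w.
Proof.
case/dcosetP=> y [z [yB zA ->]]; apply/setP => u; apply/dcosetP/dcosetP.
  case=> y' [z' [yB' zA' ->]]; exists (y' * y), (z * z').
  by split; rewrite ?young_subgroupM // !mulgA.
case=> y' [z' [yB' zA' ->]]; exists (y' * y^-1), (z^-1 * z').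
split; rewrite ?young_subgroupM ?young_subgroup_inv //.
by rewrite !mulgA mulgKV -[_ * z * z^-1]mulgA mulgV mulg1.
Qed.

(** The minimizer inside [min_length], so that [min_length c] is its length by definition. *)
Definition min_elt (c : {set 'S_n}) : 'S_n :=
  [arg min_(w < fingroup.repr c in c) coxeter_length w].

Lemma min_eltP (c : {set 'S_n}) w : w \in c ->
  min_elt c \in c /\ forall x, x \in c -> coxeter_length (min_elt c) <= coxeter_length x.
Proof. by move=> cw; rewrite /min_elt; case: arg_minnP; first exact: mem_repr cw. Qed.

(** Right multiplication of [w] by [young_subgroup n al] leaves this word unchanged; left
    multiplication by [young_subgroup n be] permutes positions within the blocks of [be]. *)
Definition coset_word (w : 'S_n) : seq nat := [seq reshape_index al (w i) | i <- enum 'I_n].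

Lemma size_coset_word w : size (coset_word w) = n.
Proof. by rewrite size_map size_enum_ord. Qed.

Lemma nth_coset_word w (i : 'I_n) : nth 0 (coset_word w) i = reshape_index al (w i).
Proof. by rewrite (nth_map i) ?size_enum_ord // nth_ord_enum. Qed.

(** Multiplying by a simple transposition inside a block, on either side, stays in the double coset
    and cannot shorten [x]; the right side is reduced to the left one by inversion. *)
Lemma min_elt_incr w : let x := min_elt (dcoset w) in
  (forall i j : 'I_n, i < j -> reshape_index be i = reshape_index be j -> x i < x j) /\
  (forall i j : 'I_n, i < j -> reshape_index al i = reshape_index al j -> x^-1 i < x^-1 j).
Proof.
move: (min_eltP (dcoset_refl w)); move: (min_elt _) => x [+ xmin].
case/dcosetP=> y [z [yB zA xE]].
split.
  apply: (increasing_on_blocks (@reshape_index_mono be)) => i j ij bij.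
  apply: xmin; apply/dcosetP; exists (tperm i j * y), z.
  by rewrite xE !mulgA; split=> //; apply: young_subgroupM (young_subgroup_tperm bij) yB.
apply: (increasing_on_blocks (@reshape_index_mono al)) => i j ij bij.
rewrite -[in leqRHS]coxeter_lengthV invMg invgK tpermV coxeter_lengthV.
apply: xmin; apply/dcosetP; exists y, (z * tperm i j).
by rewrite xE !mulgA; split=> //; apply: young_subgroupM zA (young_subgroup_tperm bij).
Qed.

Lemma seq_inv_sum (v : seq nat) : seq_inv v =
  \sum_(i < size v) \sum_(j < size v) ((i < j) && (nth 0 v j < nth 0 v i)).
Proof.
rewrite -word_invE /word_inv -sum1_card.
under eq_bigl => p do rewrite inE.
rewrite big_mkcond /= pair_bigA; apply: eq_bigr => p _ /=.
by case: andb.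
Qed.

(** As [x^-1] increases on the blocks of [al], values in one block never form an inversion, so
    replacing values by block letters loses none. *)
Lemma seq_inv_coset_word w : let x := min_elt (dcoset w) in
  seq_inv (coset_word x) = inv_count x.
Proof.
move=> x; have [_ Hx] := min_elt_incr w.
rewrite seq_inv_sum size_coset_word pair_bigA /inv_count -sum1_card [RHS]big_mkcond /=.
apply: eq_bigr => -[i j] _; rewrite inE /= !nth_coset_word.
case: (ltnP i j) => ij //=.
suff -> : (reshape_index al (x j) < reshape_index al (x i)) = (x j < x i) by case: ltnP.
apply/idP/idP => H.
  by rewrite ltnNge; apply: contraL H => /(@reshape_index_mono al); rewrite -leqNgt.
have := @reshape_index_mono al _ _ (ltnW H); rewrite leq_eqVlt => /orP[/eqP E|//].
by have := Hx _ _ H E; rewrite !permK ltnNge (ltnW ij).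
Qed.

Lemma coset_word_inj w x : coset_word w = coset_word x -> dcoset w = dcoset x.
Proof.
move=> E; apply/esym/dcoset_eq/dcosetP; exists 1, (w^-1 * x); split.
- exact: young_subgroup1.
- rewrite inE; apply/forallP => i; rewrite permM.
  by rewrite -nth_coset_word -E nth_coset_word permKV.
by rewrite mul1g mulKVg.
Qed.

Lemma perm_map_enum (T : eqType) (f : 'I_n -> T) (y : 'S_n) :
  perm_eq [seq f (y i) | i <- enum 'I_n] [seq f i | i <- enum 'I_n].
Proof.
rewrite (map_comp f y); apply: perm_map; apply: uniq_perm.
- by rewrite map_inj_uniq ?enum_uniq //; apply: perm_inj.
- exact: enum_uniq.
by move=> i; rewrite mem_enum inE; apply/mapP; exists (y^-1 i); rewrite ?mem_enum ?permKV.
Qed.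

Lemma coset_word_perm w : perm_eq (coset_word w) (block_word (rev al)).
Proof.
have -> : block_word (rev al) = [seq reshape_index al (i : 'I_n) | i <- enum 'I_n].
  apply: (@eq_from_nth _ 0).
    by rewrite size_block_word sumn_rev aln size_map size_enum_ord.
  move=> i; rewrite size_block_word sumn_rev => ial.
  have iN : i < n by rewrite -aln.
  rewrite -reshape_index_block_word // (nth_map (Ordinal iN)) ?size_enum_ord //.
  by rewrite (nth_ord_enum (Ordinal iN) (Ordinal iN)).
exact: (perm_map_enum (fun i : 'I_n => reshape_index al i)).
Qed.

Lemma coset_word_sorted w : block_sorted (rev be) (coset_word (min_elt (dcoset w))).
Proof.
have [Hx _] := min_elt_incr w.
move=> i j ij; rewrite size_coset_word => jn; have iN := ltn_trans ij jn.
rewrite -!reshape_index_block_word ?ben // => E.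
rewrite (nth_coset_word _ (Ordinal iN)) (nth_coset_word _ (Ordinal jn)).
by apply: reshape_index_mono; apply/ltnW/Hx.
Qed.

Definition lex_le (p q : nat * nat) : bool := (p.1 < q.1) || (p.1 == q.1) && (p.2 <= q.2).

Lemma block_sorted_uniq (v v' : seq nat) (y : 'S_n) : size v = n -> size v' = n ->
  block_sorted (rev be) v -> block_sorted (rev be) v' -> y \in young_subgroup n be ->
  (forall i : 'I_n, nth 0 v' i = nth 0 v (y i)) -> v' = v.
Proof.
move=> sv sv' bv bv' yB vv'.
(* Both words are read off the same multiset of pairs (block, letter), sorted
   lexicographically. *)
pose P u := [seq (reshape_index be (i : 'I_n), nth 0 u i) | i <- enum 'I_n].
have tr : transitive lex_le by move=> [? ?] [? ?] [? ?]; rewrite /lex_le /=; lia.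
have an : antisymmetric lex_le.
  by move=> [a b] [c d]; rewrite /lex_le /= => H; congr (_, _); lia.
have nthP u i : i < n -> nth (0, 0) (P u) i = (reshape_index be i, nth 0 u i).
  move=> iN; rewrite (nth_map (Ordinal iN)) ?size_enum_ord //.
  by rewrite (nth_ord_enum (Ordinal iN) (Ordinal iN)).
have srt u : size u = n -> block_sorted (rev be) u -> sorted lex_le (P u).
  move=> su bu; apply/(sortedP (0, 0)) => i; rewrite size_map size_enum_ord => iN.
  rewrite !nthP ?(ltnW iN) // /lex_le /=.
  have := @reshape_index_mono be _ _ (leqnSn i); rewrite leq_eqVlt => /orP[/eqP E|->//].
  rewrite E eqxx ltnn /=; apply: bu; rewrite ?su //.
  by rewrite -!reshape_index_block_word ?ben // ltnW.
have pP : perm_eq (P v') (P v).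
  apply: perm_trans (perm_map_enum (fun i : 'I_n => (reshape_index be i, nth 0 v i)) y).
  suff -> : P v' = [seq (reshape_index be (y i), nth 0 v (y i)) | i <- enum 'I_n].
    exact: perm_refl.
  apply: eq_map => i; rewrite vv'.
  by move: yB; rewrite inE => /forallP/(_ i)/eqP ->.
have PE : P v' = P v by apply: (sorted_eq tr an); rewrite ?srt.
apply: (@eq_from_nth _ 0); rewrite ?sv // sv' => i iN.
by move/(congr1 (fun s => (nth (0, 0) s i).2)): PE; rewrite !nthP.
Qed.

Local Open Scope ring_scope.

(** The map from [c] to [coset_word (min_elt c)] is a bijection onto the block-sorted words, and it
    turns length into inversions. *)
Lemma sum_double_cosets (k : pzRingType) :
  \sum_(c in double_cosets n be al) (-1) ^+ min_length c =
  \sum_(v <- block_words (rev al) (rev be)) (-1) ^+ seq_inv v :> k.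
Proof.
have DC c : c \in double_cosets n be al -> exists2 w, c = dcoset w & dcoset (min_elt c) = c.
  case/imsetP=> w _ ->; exists w => //.
  by have [H _] := min_eltP (dcoset_refl w); apply: dcoset_eq H.
have rev_sum : sumn (rev be) = sumn (rev al) by rewrite !sumn_rev aln ben.
rewrite (perm_big [seq coset_word (min_elt c) | c <- enum (double_cosets n be al)]); last first.
  apply: uniq_perm; first exact: uniq_block_words.
    rewrite map_inj_in_uniq ?enum_uniq // => c c'; rewrite !mem_enum.
    by move=> /DC[_ _ E] /DC[_ _ E'] /coset_word_inj; rewrite E E'.
  move=> v; apply/idP/mapP => [/(mem_block_words _ rev_sum)[pv bv]|[c + ->]]; last first.
    rewrite mem_enum => /DC[w -> _]; apply/(mem_block_words _ rev_sum); split.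
      exact: coset_word_perm.
    exact: coset_word_sorted.
  have pv1 : perm_eq v (coset_word 1).
    by apply: perm_trans pv _; rewrite perm_sym coset_word_perm.
  have sz1 : size (coset_word 1) == n by rewrite size_coset_word.
  have /tuple_permP[p vp] : perm_eq v (Tuple sz1) by [].
  have vE : v = coset_word p.
    rewrite vp; apply: (@eq_from_nth _ 0%N); rewrite size_tuple ?size_coset_word // => i iN.
    rewrite (nth_coset_word p (Ordinal iN)) -(tnth_nth 0%N _ (Ordinal iN)) tnth_mktuple.
    by rewrite (tnth_nth 0%N) /= nth_coset_word perm1.
  exists (dcoset p); first by rewrite mem_enum; apply/imsetP; exists p.
  (* The word of the minimal element rearranges [v] within the blocks of [be]; both are sorted
     there, hence equal. *)
  have [/dcosetP[y [z [yB zA xE]]] _] := min_eltP (dcoset_refl p).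
  apply/esym/(block_sorted_uniq _ _ _ _ yB); rewrite ?size_coset_word //.
  - by rewrite vE size_coset_word.
  - exact: coset_word_sorted.
  move=> i; rewrite vE !nth_coset_word xE !permM.
  by move: zA; rewrite inE => /forallP/(_ (p (y i)))/eqP ->.
rewrite big_map big_enum /=; apply: eq_bigr => c /DC[w -> _].
by rewrite seq_inv_coset_word -coxeter_lengthE.
Qed.

End DoubleCosetSum.

(** * The form on odd symmetric functions *)

Section OddForm.
Local Open Scope ring_scope.
Variable k : comNzRingType.

Lemma hform_coef_kostka (be al : seq nat) : sumn be = sumn al ->
  hform_coef k be al = (kostka_pairing (sumn al) (rev al) (rev be))%:~R.
Proof.
move=> ab; rewrite /hform_coef ab eqxx sum_double_cosets //.
rewrite -(@sum_block_words (sumn al)) ?sumn_rev // rmorph_sum /=.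
by apply: eq_bigr => v _; rewrite rmorphXn rmorphN1.
Qed.

Lemma tableau_sign_sqr T : tableau_sign T * tableau_sign T = 1.
Proof. by rewrite /tableau_sign -expr2 sqrr_sign. Qed.

(** This is (1); the sign of the canonical tableau occurs twice and cancels. *)
Lemma hform_coef_odd_kostka n (be al : seq nat) : 0%N \notin be -> 0%N \notin al ->
  sumn be = n -> sumn al = n ->
  hform_coef k be al = \sum_(la : intpart n) (-1) ^+ bin2_part (conj_part la)
    * (odd_kostka la be)%:~R * (odd_kostka la al)%:~R.
Proof.
move=> be0 al0 ben aln; rewrite hform_coef_kostka ?aln ?ben //.
rewrite kostka_pairing_parts ?sumn_rev // rmorph_sum; apply: eq_bigr => la _.
rewrite /odd_kostka !sum_tableaux_part // !rmorphM /= rmorphXn rmorphN1.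
move: (congr1 (fun x : int => x%:~R : k) (tableau_sign_sqr (canonical_tableau la))).
rewrite rmorphM /= => E; rewrite -mulrA -mulrA; congr (_ * _).
rewrite [RHS](_ : _ = ((tableau_sign (canonical_tableau la))%:~R * (tableau_sign (canonical_tableau la))%:~R)
  * ((kostka_rec (rev al) (part_box la))%:~R * (kostka_rec (rev be) (part_box la))%:~R)); last by ring.
by rewrite E mul1r.
Qed.

(** The signs of the canonical tableaux are invertible and can be absorbed into [x]. *)
Lemma odd_kostka_inj n (x : intpart n -> k) :
  (forall mu : intpart n, \sum_(la : intpart n) (odd_kostka la mu)%:~R * x la = 0) ->
  forall la, x la = 0.
Proof.
move=> H la; pose sg (nu : intpart n) : k := (tableau_sign (canonical_tableau nu))%:~R.
have sgK nu : sg nu * sg nu = 1 by rewrite /sg -rmorphM /= tableau_sign_sqr.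
have : sg la * x la = 0.
  apply: (kostka_rec_inj (x := fun nu => sg nu * x nu)) => mu.
  apply: etrans (H mu); apply: eq_bigr => nu _.
  by rewrite /odd_kostka sum_tableaux_part ?part_pos // rmorphM /= -/(sg nu) mulrA (mulrC (sg nu)).
by move/(congr1 ( *%R (sg la))); rewrite mulrA sgK mul1r mulr0.
Qed.

Definition word_of_comp (al : seq nat) : {fmonom nat} := FMonom (map predn al).

Lemma word_of_compK al : 0%N \notin al -> comp_of_word (word_of_comp al) = al.
Proof.
rewrite /comp_of_word /=; elim: al => //= a al IH; rewrite inE negb_or => /andP[a0 /IH ->].
by rewrite prednK // lt0n eq_sym.
Qed.

Lemma comp_of_word_pos u : 0%N \notin comp_of_word u.
Proof. by apply/mapP => -[]. Qed.

Lemma hprodE al : 0%N \notin al -> hprod k al = << word_of_comp al >>.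
Proof.
elim: al => [|a al IH].
  by move=> _; rewrite /hprod big_nil; congr << _ >>; apply: val_inj; rewrite /= fm1.
rewrite inE negb_or => /andP[a0 /IH {}IH].
rewrite /hprod big_cons -/(hprod k al) IH; case: a a0 => // a _ /=.
rewrite malgM_def fgmulUU mulr1; congr << _ >>.
by apply: val_inj; rewrite /= fmM fmU.
Qed.

Lemma hformU (u v : {fmonom nat}) : hform << u >> << v >> =
  hform_coef k (comp_of_word u) (comp_of_word v).
Proof. by rewrite /hform !msuppU1 !big_seq_fset1 !mcoeffUU !mul1r. Qed.

Lemma hform_expand (y z : free_hsym k) :
  hform y z = \sum_(v <- msupp z) z@_v * hform y << v >>.
Proof.
rewrite /hform exchange_big; apply: eq_bigr => v _ /=; rewrite big_distrr /=.
apply: eq_bigr => u _; rewrite msuppU1 big_seq_fset1 mcoeffUU mulr1.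
by rewrite mulrA (mulrC (z@_v)).
Qed.

Lemma hform_homogeneous n (y : free_hsym k) v : homogeneous n y ->
  sumn (comp_of_word v) != n -> hform y << v >> = 0.
Proof.
move=> hy nv; rewrite /hform msuppU1 big_seq big1 // => u uy.
by rewrite big_seq_fset1 /hform_coef (hy u uy) eq_sym (negPf nv) mulr0.
Qed.

Definition hcomp (al : seq nat) : odd_sym k := to_odd_sym (hprod k al).

Lemma odd_formC (x y : odd_sym k) : odd_form x y = odd_form y x.
Proof. exact: hformC. Qed.

Lemma odd_form_linear c (x1 x2 y : odd_sym k) :
  odd_form (c *: x1 + x2) y = c * odd_form x1 y + odd_form x2 y.
Proof.
rewrite -(lift_hsymK x1) -(lift_hsymK x2) -(lift_hsymK y).
rewrite -[c *: _]/(odd_sym_scale c _) odd_sym_scale_pi -to_odd_symD !odd_form_pi.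
exact: hform_linearl.
Qed.

Lemma odd_form0 (y : odd_sym k) : odd_form 0 y = 0.
Proof. by have := odd_form_linear (-1) 0 0 y; rewrite scaler0 addr0 mulN1r addNr. Qed.

Lemma odd_formZ c (x y : odd_sym k) : odd_form (c *: x) y = c * odd_form x y.
Proof. by rewrite -[c *: x]addr0 odd_form_linear odd_form0 addr0. Qed.

Lemma odd_formB (x1 x2 y : odd_sym k) : odd_form (x1 - x2) y = odd_form x1 y - odd_form x2 y.
Proof. by rewrite addrC -scaleN1r odd_form_linear mulN1r addrC. Qed.

Lemma odd_form_sum (I : finType) (c : I -> k) (x : I -> odd_sym k) (y : odd_sym k) :
  odd_form (\sum_i c i *: x i) y = \sum_i c i * odd_form (x i) y.
Proof.
elim/big_rec2: _ => [|i a b _ <-]; first exact: odd_form0.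
exact: odd_form_linear.
Qed.

Lemma odd_form_hcomp n be al : 0%N \notin be -> 0%N \notin al -> sumn be = n -> sumn al = n ->
  odd_form (hcomp be) (hcomp al) = \sum_(la : intpart n) (-1) ^+ bin2_part (conj_part la)
    * (odd_kostka la be)%:~R * (odd_kostka la al)%:~R.
Proof.
move=> be0 al0 ben aln; rewrite odd_form_pi !hprodE // hformU !word_of_compK //.
exact: hform_coef_odd_kostka.
Qed.

Lemma odd_form_deg n (x : odd_sym k) al : odd_sym_deg n x -> 0%N \notin al -> sumn al != n ->
  odd_form x (hcomp al) = 0.
Proof.
case=> y hy -> al0 aln; rewrite odd_form_pi hprodE //.
by apply: hform_homogeneous hy _; rewrite word_of_compK.
Qed.

Lemma odd_form_hcomp_deg be al : 0%N \notin be -> 0%N \notin al -> sumn be != sumn al ->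
  odd_form (hcomp be) (hcomp al) = 0.
Proof.
move=> be0 al0 ba; rewrite odd_form_pi !hprodE // hformU !word_of_compK //.
by rewrite /hform_coef (negPf ba).
Qed.

(** The products of generators span the free algebra, so a lift of [x] lies in the radical. *)
Lemma odd_form_nondegenerate (x : odd_sym k) :
  (forall al, 0%N \notin al -> odd_form x (hcomp al) = 0) -> x = 0.
Proof.
rewrite -(lift_hsymK x); move: (lift_hsym x) => {}x H.
have <- : to_odd_sym (0 : free_hsym k) = 0.
  by apply: (addrI (to_odd_sym 0)); rewrite -to_odd_symD !addr0.
apply/to_odd_symP; rewrite subr0; apply/asboolP => z.
rewrite hform_expand big1 // => v _.
have := H _ (comp_of_word_pos v); rewrite odd_form_pi hprodE ?comp_of_word_pos //.
have -> : word_of_comp (comp_of_word v) = v.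
  by apply/eqP; case: v => v; rewrite /word_of_comp /comp_of_word /= -map_comp map_id.
by move=> ->; rewrite mulr0.
Qed.

End OddForm.

(** * From the odd Cauchy identity to the expansion of [s la] *)

Unset Implicit Arguments.

Theorem corollary3p8 (k : comNzRingType) (n : nat)
    (m s : intpart n -> odd_sym k)
    (m_dual : is_odd_monomial m) (s_schur : is_odd_schur s) (la : intpart n) :
  (-1) ^+ bin2_part (conj_part la) *: s la
    = \sum_(mu : intpart n) (odd_kostka la mu)%:~R *: m mu.
Proof.
case: m_dual => m_deg m_dual; case: s_schur => s_deg s_schur.
have sqr_eps (nu : intpart n) : (-1) ^+ bin2_part (conj_part nu) * (-1) ^+ bin2_part (conj_part nu) = 1 :> k.
  by rewrite -expr2 sqrr_sign.
(* By unitriangularity it suffices to compare after summing against [odd_kostka _ mu], where the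
   left side becomes the pairing of [h_mu] with [h_be] and (1) applies. *)
have form_s nu be : 0%N \notin be -> sumn be = n ->
    odd_form (s nu) (hcomp k be) = (-1) ^+ bin2_part (conj_part nu) * (odd_kostka nu be)%:~R.
  move=> be0 ben; apply/eqP; rewrite -subr_eq0; apply/eqP.
  apply: (odd_kostka_inj (x := fun nu => odd_form (s nu) (hcomp k be) - _)) => mu.
  under eq_bigr => ka _ do rewrite mulrBr.
  rewrite sumrB -odd_form_sum -s_schur.
  rewrite (odd_form_hcomp _ (part_pos mu) be0 (sumn_part mu) ben); apply/eqP.
  by rewrite subr_eq0; apply/eqP/eq_bigr => ka _; rewrite mulrCA mulrA.
(* The defining expansion of the [h_mu] extends from partitions to all compositions of [n]. *)
have hcompE al : 0%N \notin al -> sumn al = n ->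
    hcomp k al = \sum_(nu : intpart n) (odd_kostka nu al)%:~R *: s nu.
  move=> al0 aln; apply/eqP; rewrite -subr_eq0; apply/eqP/odd_form_nondegenerate => be be0.
  rewrite odd_formB odd_form_sum; have [ben|ben] := eqVneq (sumn be) n.
    rewrite (odd_form_hcomp _ al0 be0 aln ben); apply/eqP.
    rewrite subr_eq0; apply/eqP/eq_bigr => nu _.
    by rewrite form_s // mulrCA mulrA.
  rewrite odd_form_hcomp_deg ?aln 1?eq_sym // sub0r big1 ?oppr0 // => nu _.
  by rewrite (odd_form_deg (s_deg nu)) ?mulr0.
apply/eqP; rewrite -subr_eq0; apply/eqP; set X := _ - _.
(* [X] is orthogonal to every [h_nu] with [nu] a partition, hence to every [s ka] by
   unitriangularity. *)
have form_sX ka : odd_form (s ka) X = 0.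
  apply: (odd_kostka_inj (x := fun ka => odd_form (s ka) X)) => nu.
  rewrite -odd_form_sum -s_schur odd_formC /X odd_formB odd_formZ odd_form_sum.
  rewrite form_s ?part_pos ?sumn_part // mulrA sqr_eps mul1r.
  rewrite (bigD1 nu) //= odd_formC m_dual eqxx mulr1 big1 ?addr0 ?subrr // => mu munu.
  by rewrite odd_formC m_dual eq_sym (negPf munu) mulr0.
(* In degree [n], [hcompE] reduces [h_be] to the [s ka]; other degrees are orthogonal by the
   grading. *)
apply: odd_form_nondegenerate => be be0; have [ben|ben] := eqVneq (sumn be) n.
  rewrite odd_formC hcompE // odd_form_sum big1 // => ka _.
  by rewrite form_sX mulr0.
rewrite /X odd_formB odd_formZ odd_form_sum (odd_form_deg (s_deg la)) // mulr0 sub0r.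
by rewrite big1 ?oppr0 // => mu _; rewrite (odd_form_deg (m_deg mu)) // mulr0.
Qed.
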